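(* Let $I^n$ be the $n$-cube digraph. For all $1\le p\le n$, the canonical Hodge Laplacian $\Delta_p(I^n)$ satisfies $$\operatorname{spec}\Delta_p(I^n)=\Big\{\Big(\frac{2k}{p}\Big)_{\binom nk\binom{k-1}{p-1}}\Big\}_{k=p}^{n}\ \sqcup\ \Big\{\Big(\frac{2k}{p+1}\Big)_{\binom nk\binom{k-1}{p}}\Big\}_{k=p+1}^{n}.$$ In particular, $$\lambda_{\max}(\Delta_p(I^n))=\Big(\frac{2n}{p}\Big)_{\binom{n-1}{p-1}}\quad\text{and}\quad\lambda_{\min}(\Delta_p(I^n))=2_{\binom{n+1}{p+1}}.$$
   Context: A digraph $G=(V,E)$ consists of a finite vertex set $V$ and a set $E$ of ordered pairs of distinct vertices (arrows), written $i\to j$. An elementary $p$-path ($p\ge 0$) is a sequence $i_0\dots i_p$ of vertices, with associated basis symbol $e_{i_0\dots i_p}$; it is regular if $i_{k-1}\ne i_k$ for all $k$, and allowed if $i_{k-1}\to i_k$ for all $k$. $\mathcal R_p$ is the real vector space with basis the regular elementary $p$-paths. The boundary operator $\partial:\mathcal R_p\to\mathcal R_{p-1}$ is $\partial e_{i_0\dots i_p}=\sum_{k=0}^p(-1)^k e_{i_0\dots\widehat{i_k}\dots i_p}$, where every non-regular term on the right is replaced by $0$; and $\mathcal R_{-1}=\{0\}$, $\partial e_i=0$. $\mathcal A_p\subset\mathcal R_p$ is the span of the allowed elementary $p$-paths ($\mathcal A_{-1}=\{0\}$), and $\Omega_p=\Omega_p(G)=\{u\in\mathcal A_p:\partial u\in\mathcal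 A_{p-1}\}$. Then $\partial\Omega_p\subset\Omega_{p-1}$ and $\partial^2=0$. Canonical Hodge Laplacian: equip $\mathcal R_p$ with the inner product for which the regular elementary paths are orthonormal, restrict it to $\Omega_p$, let $\partial^*:\Omega_{p-1}\to\Omega_p$ be the adjoint of $\partial:\Omega_p\to\Omega_{p-1}$, and put $\Delta_p(G)=\partial\partial^*+\partial^*\partial:\Omega_p\to\Omega_p$. The Cartesian product $X\Box Y$ of digraphs has vertex set $X\times Y$, with $(x_1,y_1)\to(x_2,y_2)$ iff either $x_1=x_2$ and $y_1\to y_2$, or $x_1\to x_2$ and $y_1=y_2$. The interval digraph $I$ has vertices $0,1$ and the single arrow $0\to1$; the $n$-cube is $I^n=I\Box\cdots\Box I$ ($n$ factors, $n\ge1$). $\operatorname{spec}A$ is the multiset of eigenvalues of the self-adjoint operator $A$, counted with multiplicity. $(\lambda)_m$ or $\lambda_m$ inside such a multiset (or as the value of $\lambda_{\max}$, $\lambda_{\min}$) means the value $\lambda$ with multiplicity $m$. $\sqcup$ is disjoint union of multisets (multiplicities add). $\lambda_{\max}(A)$, $\lambda_{\min}(A)$ are the maximal and minimal eigenvalues. *)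

(* Defs.v *)
From HB Require Import structures.
From mathcomp Require Import all_boot all_order all_algebra.
From mathcomp Require Import finmap multiset.
From mathcomp Require Import boolp classical_sets cardinality reals.
From mathcomp Require Import zify.

Set Implicit Arguments.
Unset Strict Implicit.
Unset Printing Implicit Defensive.

Import Order.TTheory GRing.Theory Num.Theory.

Local Open Scope ring_scope.
Local Open Scope mset_scope.

Record digraph := Digraph {
  vertex :> finType;
  arrow : rel vertex;
  arrow_irr : irreflexive arrow }.

Definition interval_arrow : rel bool := fun x y => ~~ x && y.
Fact interval_arrow_irr : irreflexive interval_arrow.
Proof. by case. Qed.
Definition interval := Digraph interval_arrow_irr.

Section BoxProduct.
Variables X Y : digraph.
Definition box_arrow : rel (X * Y) := fun u v =>
  ((u.1 == v.1) && arrow u.2 v.2) || (arrow u.1 v.1 && (u.2 == v.2)).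
Fact box_arrow_irr : irreflexive box_arrow.
Proof. by move=> [x y]; rewrite /box_arrow /= !arrow_irr andbF. Qed.
Definition box := Digraph box_arrow_irr.
End BoxProduct.

Fact point_arrow_irr : irreflexive (fun _ _ : unit => false).
Proof. by []. Qed.
Definition point := Digraph point_arrow_irr.

(* [iterop] makes [cube 1] equal to [interval] and [cube n.+2] equal to
   [box interval (cube n.+1)]; [point] is only the value at [n = 0]. *)
Definition cube (n : nat) : digraph := iterop n box interval point.

(* Chains are indexed by the number [q] of vertices of a path, so that the
   space R_p is [chain q] with [q = p.+1]. The condition [0 < q] discards the
   empty path, so that [chain 0], which is R_{-1}, is the zero space. *)

Definition regular (V : finType) (q : nat) (t : q.-tuple V) : bool :=
  (0 < q)%N && sorted (fun x y => x != y) t.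

Definition rpath (V : finType) (q : nat) := {t : q.-tuple V | regular t}.

Section PathComplex.
Variables (R : realType) (G : digraph).
Implicit Types q : nat.

Definition chain q := {ffun rpath G q -> R^o}.

(* e_t, with the convention that it is 0 when t is not regular. *)
Definition epath q (t : q.-tuple G) : chain q :=
  [ffun s => (val s == t)%:R].

Definition face q (k : 'I_q.+1) (t : q.+1.-tuple G) : q.-tuple G :=
  [tuple tnth t (lift k i) | i < q].

Definition bdry_path q (t : q.+1.-tuple G) : chain q :=
  \sum_(k < q.+1) (-1) ^+ k *: epath (face k t).

Definition bdry_fun q (u : chain q.+1) : chain q :=
  \sum_(t : rpath G q.+1) (u t : R) *: bdry_path (val t).

Fact bdry_fun_linear q : linear (@bdry_fun q).
Proof.
move=> a u v; rewrite /bdry_fun scaler_sumr -big_split /=.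
by apply: eq_bigr => t _; rewrite !ffunE scalerDl scalerA.
Qed.
HB.instance Definition _ q :=
  GRing.isLinear.Build R (chain q.+1) (chain q) _ _ (@bdry_fun_linear q).

Definition bdry q : 'Hom(chain q.+1, chain q) := linfun (@bdry_fun q).

Definition allowed_path q : seq (q.-tuple G) :=
  [seq t : q.-tuple G <- enum {: q.-tuple G} | sorted (@arrow G) t].

Definition allowed q : {vspace chain q} :=
  <<[seq epath t | t <- allowed_path q]>>%VS.

(* [Omega p.+1] is the space Omega_p of the path complex. *)
Definition Omega q : {vspace chain q} :=
  match q with
  | 0 => 0%VS
  | q'.+1 => (allowed q'.+1 :&: bdry q' @^-1: allowed q')%VS
  end.

End PathComplex.

Section PathComplexTheory.
Variables (R : realType) (G : digraph).
Implicit Types q : nat.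

Fact epath_irregular q (t : q.-tuple G) : ~~ regular t -> epath R t = 0.
Proof.
move=> irr; apply/ffunP => s; rewrite !ffunE.
by case: eqP => // st; move: irr; rewrite -st (valP s).
Qed.

Fact irregularP q (t : q.-tuple G) (i j : 'I_q) :
  j = i.+1 :> nat -> tnth t i = tnth t j -> ~~ regular t.
Proof.
move=> ji tij; apply/negP => /andP[_ /(sortedP (tnth t i))].
move=> /(_ i); rewrite size_tuple -ji ltn_ord => /(_ isT).
by rewrite -!tnth_nth tij eqxx.
Qed.

Fact bdry_path_irregular q (t : q.+1.-tuple G) :
  ~~ regular t -> bdry_path R t = 0.
Proof.
move=> irr.
have [i [j [ji tij]]] : exists i j : 'I_q.+1,
    j = i.+1 :> nat /\ tnth t i = tnth t j.
  apply: contrapT => no; move/negP: irr; apply.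
  have x0 : G := tnth t ord0.
  apply/andP; split => //; apply/(sortedP x0) => i.
  rewrite size_tuple => iq; apply/eqP => tE; apply: no.
  by exists (Ordinal (ltnW iq)), (Ordinal iq); rewrite !(tnth_nth x0).
have jNi : j != i by rewrite -val_eqE /= ji gtn_eqF.
rewrite /bdry_path (bigD1 i)//= (bigD1 j)//= big1 ?addr0 => [|k /andP[ki kj]].
  have -> : face j t = face i t.
    apply: eq_from_tnth => l; rewrite !tnth_mktuple.
    have [li|li] := eqVneq (l : nat) (i : nat); last first.
      congr tnth; apply: val_inj => /=; rewrite /bump ji.
      by move: li; case: ltngtP.
    have -> : lift j l = i by apply: val_inj; rewrite /= /bump ji li ltnn.
    by rewrite tij; congr tnth; apply: val_inj; rewrite /= /bump ji li leqnn.
  by rewrite ji exprS mulN1r scaleNr subrr.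
rewrite epath_irregular ?scaler0//.
have := ltn_ord i; have := ltn_ord j; have := ltn_ord k => kq jq iq.
have {ki} /eqP ki : k != i :> nat by [].
have {kj} /eqP kj : k != j :> nat by [].
have [lt_ki|le_ik] := ltnP k i.
  have h1 : (i.-1 < q)%N by lia.
  have h2 : (i < q)%N by lia.
  apply: (@irregularP _ _ (Ordinal h1) (Ordinal h2)) => /=; first lia.
  rewrite !tnth_mktuple.
  have -> : lift k (Ordinal h1) = i by apply: val_inj; rewrite /= /bump; lia.
  have -> : lift k (Ordinal h2) = j by apply: val_inj; rewrite /= /bump; lia.
  by [].
have h1 : (i < q)%N by lia.
have h2 : (i.+1 < q)%N by lia.
apply: (@irregularP _ _ (Ordinal h1) (Ordinal h2)) => //=.
rewrite !tnth_mktuple.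
have -> : lift k (Ordinal h1) = i by apply: val_inj; rewrite /= /bump; lia.
have -> : lift k (Ordinal h2) = j by apply: val_inj; rewrite /= /bump; lia.
by [].
Qed.

Lemma bdry_epath q (t : q.+1.-tuple G) : bdry R G q (epath R t) = bdry_path R t.
Proof.
rewrite lfunE /= /bdry_fun; have [rt|irr] := boolP (regular t).
  rewrite (bigD1 (exist _ t rt))//= ffunE eqxx scale1r big1 ?addr0// => s.
  by rewrite ffunE -val_eqE /= => /negPf ->; rewrite scale0r.
rewrite bdry_path_irregular// big1// => s _; rewrite ffunE.
by case: eqP => [st|]; rewrite ?scale0r//; move: irr; rewrite -st (valP s).
Qed.

Fact face_face q (t : q.+2.-tuple G) (k k' : 'I_q.+2) (l l' : 'I_q.+1) :
  (k <= l)%N -> k' = l.+1 :> nat -> l' = k :> nat ->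
  face l (face k t) = face l' (face k' t).
Proof.
move=> kl k'E l'E; apply: eq_from_tnth => i; rewrite !tnth_mktuple.
by congr tnth; apply: val_inj; rewrite /= /bump; lia.
Qed.

Lemma bdry_bdry q (u : chain R G q.+2) : bdry R G q (bdry R G q.+1 u) = 0.
Proof.
rewrite [bdry _ _ q.+1 u]lfunE /= /bdry_fun linear_sum big1//= => t _.
rewrite linearZ /= /bdry_path linear_sum /= -[RHS](scaler0 _ (u t)).
congr (_ *: _); move: (val t) => {u}t.
pose F (x : 'I_q.+2 * 'I_q.+1) : chain R G q :=
  (-1) ^+ (x.1 + x.2) *: epath R (face x.2 (face x.1 t)).
have -> : \sum_(k < q.+2) bdry R G q ((-1) ^+ k *: epath R (face k t)) =
    \sum_x F x.
  rewrite -(pair_bigA _ (fun k l => F (k, l))) /=; apply: eq_bigr => k _.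
  rewrite linearZ /= bdry_epath scaler_sumr; apply: eq_bigr => l _.
  by rewrite scalerA -exprD.
rewrite (bigID (fun x : 'I_q.+2 * 'I_q.+1 => (x.1 <= x.2)%N)) /=.
pose h (x : 'I_q.+2 * 'I_q.+1) : 'I_q.+2 * 'I_q.+1 := (inord x.2.+1, inord x.1).
pose h' (x : 'I_q.+2 * 'I_q.+1) : 'I_q.+2 * 'I_q.+1 := (inord x.2, inord x.1.-1).
rewrite [X in _ + X](reindex_onto h h') /=; last first.
  move=> [k l] /=; rewrite -ltnNge => lk; have := ltn_ord k; have := ltn_ord l.
  move=> lq kq; congr pair; apply: val_inj; rewrite /= !inordK; lia.
apply/eqP; rewrite addr_eq0 -sumrN; apply/eqP; apply: eq_big => [|[k l] /= kl].
  move=> [k l] /=; have := ltn_ord k; have := ltn_ord l => lq kq.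
  rewrite /h' /h /= xpair_eqE -!val_eqE /=.
  have yq := ltn_ord (inord k : 'I_q.+1).
  rewrite (@inordK q.+1 l.+1)// (@inordK q l.+1.-1)//.
  rewrite (@inordK q.+1 (inord k : 'I_q.+1)); last lia.
  have [k1|k1] := leqP k q; last lia.
  by rewrite (@inordK q k)//; lia.
rewrite /F /h /=; have := ltn_ord k; have := ltn_ord l => lq kq.
rewrite (@face_face _ _ k (inord l.+1) l (inord k)) ?inordK//; try lia.
by rewrite addSn exprS mulN1r scaleNr opprK addnC.
Qed.

Lemma bdry_Omega q u : u \in Omega R G q.+1 -> bdry R G q u \in Omega R G q.
Proof.
rewrite /= memv_cap -memv_preim => /andP[_ du].
case: q u du => [|q] u du /=.
  suff -> : bdry R G 0 u = 0 by rewrite mem0v.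
  by apply/ffunP => -[t rt].
by rewrite memv_cap du -memv_preim bdry_bdry mem0v.
Qed.

End PathComplexTheory.

Section Adjoint.
Variable R : realType.

Definition dotp (A : finType) (u v : {ffun A -> R^o}) : R :=
  \sum_(a : A) (u a : R) * (v a : R).

Fact dotpC (A : finType) (u v : {ffun A -> R^o}) : dotp u v = dotp v u.
Proof. by apply: eq_bigr => a _; rewrite mulrC. Qed.

Fact dotp_linear (A : finType) (u : {ffun A -> R^o}) :
  linear (dotp u : {ffun A -> R^o} -> R^o).
Proof.
move=> c v w; rewrite /dotp scaler_sumr -big_split /=; apply: eq_bigr => a _.
by rewrite !ffunE /GRing.scale /= mulrDr mulrCA.
Qed.
HB.instance Definition _ (A : finType) (u : {ffun A -> R^o}) :=
  GRing.isLinear.Build R {ffun A -> R^o} R^o _ (@dotp A u) (dotp_linear u).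

Fact dotp_eq0 (A : finType) (u : {ffun A -> R^o}) : dotp u u = 0 -> u = 0.
Proof.
move=> /psumr_eq0P u0; apply/ffunP => a; rewrite ffunE.
by apply/eqP; rewrite -sqrf_eq0 expr2 u0// => b _; rewrite -expr2 sqr_ge0.
Qed.

Variables (S T : finType).
Variables (U : {vspace {ffun S -> R^o}}) (W : {vspace {ffun T -> R^o}}).

Definition is_adjoint (f : 'Hom(subvs_of U, subvs_of W))
    (g : 'Hom(subvs_of W, subvs_of U)) : Prop :=
  forall x y, dotp (vsval (f x)) (vsval y) = dotp (vsval x) (vsval (g y)).

(* Lemma [adjointP] shows that the set is nonempty, and [is_adjoint_inj] that
   it has only one element, so that the default value 0 plays no role. *)
Definition adjoint (f : 'Hom(subvs_of U, subvs_of W)) :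
    'Hom(subvs_of W, subvs_of U) :=
  xget 0 [set g | is_adjoint f g]%classic.

Implicit Types (f : 'Hom(subvs_of U, subvs_of W)).

Lemma is_adjoint_inj f g h : is_adjoint f g -> is_adjoint f h -> g = h.
Proof.
move=> fg fh; apply/lfunP => y; apply/eqP; rewrite -subr_eq0; apply/eqP.
apply: val_inj; apply: dotp_eq0; set z := g y - h y.
have -> : dotp (val z) (val z) =
    dotp (vsval z) (vsval (g y)) - dotp (vsval z) (vsval (h y)).
  by rewrite {2}/z !linearB.
by rewrite -fg -fh subrr.
Qed.

Section Existence.
Let m := \dim {:subvs_of U}.
Let b : m.-tuple (subvs_of U) := vbasis {:subvs_of U}.

Definition riesz_fun (x : subvs_of U) : 'rV[R]_m :=
  \row_i dotp (vsval (tnth b i)) (vsval x).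
Fact riesz_lin : linear riesz_fun.
Proof. by move=> c x y; apply/rowP => i; rewrite !mxE !linearP. Qed.
HB.instance Definition _ :=
  GRing.isLinear.Build R (subvs_of U) 'rV[R]_m _ riesz_fun riesz_lin.
Let riesz : 'Hom(subvs_of U, 'rV[R]_m) := linfun riesz_fun.

Variable f : 'Hom(subvs_of U, subvs_of W).
Definition dual_fun (y : subvs_of W) : 'rV[R]_m :=
  \row_i dotp (vsval (f (tnth b i))) (vsval y).
Fact dual_lin : linear dual_fun.
Proof. by move=> c x y; apply/rowP => i; rewrite !mxE !linearP. Qed.
HB.instance Definition _ :=
  GRing.isLinear.Build R (subvs_of W) 'rV[R]_m _ dual_fun dual_lin.

Let basis_sum (x : subvs_of U) : x = \sum_i coord b i x *: tnth b i.
Proof.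
rewrite {1}(coord_vbasis (memvf x)).
by apply: eq_bigr => i _; rewrite (tnth_nth 0).
Qed.

Let riesz_ker : lker riesz == 0%VS.
Proof.
rewrite -subv0; apply/subvP => x; rewrite memv_ker lfunE /= memv0 => /eqP/rowP x0.
apply/eqP/val_inj/dotp_eq0; rewrite {2}(basis_sum x) !linear_sum /= big1// => i _.
by rewrite !linearZ /= dotpC; move: (x0 i); rewrite !mxE => ->; rewrite scaler0.
Qed.

Let riesz_surj z : exists x, riesz x = z.
Proof.
suff /memv_imgP[x _ ->] : z \in limg riesz by exists x.
suff -> : limg riesz = fullv by rewrite memvf.
apply/eqP; rewrite eqEdim subvf /= limg_dim_eq.
  by rewrite !dimvf /= /dim /= mul1n -/m /m dimvf.
by rewrite (eqP riesz_ker) capv0.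
Qed.

Lemma ex_adjoint : exists g, is_adjoint f g.
Proof.
exists (riesz^-1 \o linfun dual_fun)%VF => x y.
rewrite comp_lfunE; set w := (riesz^-1)%VF _.
have /rowP wE : riesz w = dual_fun y.
  have [v vE] := riesz_surj (dual_fun y).
  by rewrite /w [linfun dual_fun y]lfunE /= -vE (lker0_lfunK riesz_ker).
rewrite (basis_sum x) !linear_sum /= dotpC [RHS]dotpC !linear_sum /=.
apply: eq_bigr => i _; rewrite !linearZ /=.
by move: (wE i); rewrite lfunE /= !mxE [RHS]dotpC => <-; rewrite [in RHS]dotpC.
Qed.
End Existence.

Lemma adjointP f : is_adjoint f (adjoint f).
Proof.
have [g gP] := ex_adjoint f.
by rewrite /adjoint; case: xgetP => [h _ //|/(_ g)].
Qed.
End Adjoint.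

HB.instance Definition _ (K : choiceType) :=
  Monoid.isComLaw.Build {mset K} mset0 msetD (@msetDA K) (@msetDC K) (@mset0D K).

Section Spectrum.
Variables (R : realType) (V : vectType R).

Fact finite_roots (P : {poly R}) :
  P != 0 -> finite_set [set a | root P a]%classic.
Proof.
elim: {P}(size P) {-2}P (leqnn (size P)) => [|m IH] P sP P0.
  by move: sP; rewrite leqn0 size_poly_eq0 (negPf P0).
have [[b rb]|noroot] := pselect (exists b, root P b); last first.
  suff -> : [set a | root P a]%classic = set0 by [].
  by rewrite -subset0 => b /= rb; case: noroot; exists b.
have /factor_theorem[Q PE] := rb; have Q0 : Q != 0.
  by apply: contraNneq P0 => Q0; rewrite PE Q0 mul0r.
apply: (@sub_finite_set _ _ ([set b] `|` [set a | root Q a])%classic).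
  by move=> a /=; rewrite PE rootM root_XsubC orbC => /orP[/eqP ->|]; [left|right].
rewrite finite_setU; split => //; apply: IH => //.
by move: sP; rewrite PE size_Mmonic ?monicXsubC// size_XsubC addnC.
Qed.

Fact finite_leigenvalue (f : 'End(V)) :
  finite_set [set a | passmx.leigenvalue f a]%classic.
Proof.
pose M := passmx.mxof (vbasis {:V}) (vbasis {:V}) f.
have cM0 : char_poly M != 0 by rewrite monic_neq0// char_poly_monic.
apply: sub_finite_set (finite_roots cM0) => a /=.
have bV := vbasisP {:V}.
rewrite /passmx.leigenvalue (passmx.leigenspaceE bV).
by rewrite (passmx.vsof_eq0 bV) -eigenvalue_root_char.
Qed.

(* For a self-adjoint operator the multiplicity of an eigenvalue is the
   dimension of its eigenspace; see [specE]. *)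
Definition spec (f : 'End(V)) : {mset R} :=
  [fsfun a in fset_set [set a | passmx.leigenvalue f a]%classic
     => \dim (passmx.leigenspace f a)].

Lemma specE (f : 'End(V)) a : spec f a = \dim (passmx.leigenspace f a).
Proof.
rewrite fsfunE in_fset_set; last exact: finite_leigenvalue.
case: ifPn => //; rewrite notin_setE /= => /negP.
by rewrite negbK => /eqP ->; rewrite dimv0.
Qed.

Definition lambda_max (f : 'End(V)) (a : R) (m : nat) : Prop :=
  [/\ a \in spec f, forall b, b \in spec f -> b <= a & spec f a = m].

Definition lambda_min (f : 'End(V)) (a : R) (m : nat) : Prop :=
  [/\ a \in spec f, forall b, b \in spec f -> a <= b & spec f a = m].

End Spectrum.

Section Laplacian.
Variables (R : realType) (G : digraph).
Implicit Types q p : nat.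

(* [vsproj U] is the identity on [U], and Lemma [bdry_Omega] shows that the
   boundary of an element of [Omega q.+1] is in [Omega q]. *)
Definition dOmega q :
    'Hom(subvs_of (Omega R G q.+1), subvs_of (Omega R G q)) :=
  linfun (vsproj (Omega R G q) \o bdry R G q \o vsval).

Lemma dOmegaE q (u : subvs_of (Omega R G q.+1)) :
  vsval (dOmega q u) = bdry R G q (vsval u).
Proof. by rewrite lfunE /= vsprojK// bdry_Omega// subvsP. Qed.

(* With the shift of indices, [dOmega p] is the boundary on Omega_p and
   [dOmega p.+1] is the boundary on Omega_(p+1). *)
Definition Laplacian p : 'End(subvs_of (Omega R G p.+1)) :=
  ((dOmega p.+1 \o adjoint (dOmega p.+1))
   + (adjoint (dOmega p) \o dOmega p))%VF.

End Laplacian.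

(* Main.v *)
From HB Require Import structures.
Require Import Defs.
From mathcomp Require Import all_boot all_order all_algebra.
From mathcomp Require Import finmap multiset reals.
From mathcomp Require Import zify ring lra.

(** Why the theorem holds.

    Identify the vertices of the cube with the subsets of ['I_n]; an arrow adds
    one element.  An allowed path from [A] to [B] orders the elements of
    [B :\: A].  Deleting an interior vertex of an allowed path gives a path
    that is not allowed, and exactly two allowed paths fill the gap, the two
    sides of a square.  Hence a chain of allowed paths belongs to Omega if and
    only if its coefficients change sign whenever a path is flipped across a
    square.  The sign [path_sgn] also changes under flips, because the signs
    [step_sgn] of the arrows make every square anticommute; and flips connect
    all paths with the same end points ([path_flip_connected]).  So the elements
    of Omega are the chains [theta p g], with an arbitrary function [g] of the
    end points of a path ([bdry_theta], [Omega_theta]).  On them only the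
    deletion of an end point contributes to the boundary.

    The boundary commutes with translations, so characters diagonalise it.  For
    [J] included in [K], with [#|J| = p], let [cube_chain p K J] be the chain
    that carries the character [K] over the faces with directions [J].  Up to
    signs, its boundary is the sum of the chains [(K, J :\ j)] with [j] in [J]
    ([end_bdry_cube]).  These chains are pairwise orthogonal, with square norm
    [p! 2 ^ (n - p)] ([dotp_cube_chain]): an interval of length [p] has [p!]
    maximal chains, and [2 ^ (n - p)] faces have the directions [J].  There are
    as many of them as intervals of length [p], so they form a basis of Omega.
    The ratio [2 / p.+1] of consecutive square norms is the coefficient in the
    adjoint of the boundary ([adjoint_cube_form]).

    For a fixed [K] with [k] elements the chains thus form the exterior algebra
    on [k] directions, with its Koszul differential, and [p.+1] times
    [d d^*] plus [p] times [d^* d] is multiplication by [2 k]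
    ([hodge_identity]).  As [d d = 0], a boundary is an eigenvector of the
    Laplacian with eigenvalue [2 k / p.+1], and a coboundary is one with
    eigenvalue [2 k / p].  A pivot direction in each [K] selects a basis of
    eigenvectors ([spec_faces]): those of the first kind correspond to the sets
    [J] that avoid the pivot, and there are ['C(k.-1, p)] of them; those of the
    second kind correspond to the sets [J] that contain it, and there are
    ['C(k.-1, p.-1)].  Summing over the ['C(n, k)] subsets [K] gives the
    spectrum, from which the extreme eigenvalues are read off. *)

Set Implicit Arguments.
Unset Strict Implicit.
Unset Printing Implicit Defensive.

Import Order.TTheory GRing.Theory Num.Theory.

Local Open Scope ring_scope.
Local Open Scope mset_scope.

(** * Signs and oriented steps in the Boolean lattice *)

Section Signs.
Variables (R : realType) (n : nat).
Implicit Types (P Q A B J K X : {set 'I_n}) (i j l m : 'I_n).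

(** For disjoint [P] and [Q], the sign of the shuffle that sorts the elements of
    [P] followed by those of [Q].  It is multiplicative in both arguments, which
    reduces all later sign computations to singletons. *)
Definition sgn P Q : R :=
  \prod_(x in P) \prod_(i in Q) (if (i < x)%N then -1 else 1).

Lemma sgnU1 l P Q : l \notin P -> sgn (l |: P) Q = sgn [set l] Q * sgn P Q.
Proof. by move=> lP; rewrite /sgn big_setU1//= big_set1. Qed.

Lemma sgnUr P Q Q' :
  [disjoint Q & Q'] -> sgn P (Q :|: Q') = sgn P Q * sgn P Q'.
Proof.
move=> dQ; rewrite -big_split; apply: eq_bigr => x _ /=.
by rewrite -bigU//; apply: eq_bigl => i; rewrite !inE.
Qed.

Lemma sgnU1r P j Q : j \notin Q -> sgn P (j |: Q) = sgn P [set j] * sgn P Q.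
Proof. by move=> jQ; rewrite sgnUr// disjoints1. Qed.

Lemma sgn_sq P Q : sgn P Q * sgn P Q = 1.
Proof.
rewrite -big_split /= big1// => x _; rewrite -big_split /= big1// => i _.
by case: ifP; rewrite ?mulrNN mulr1.
Qed.

Lemma sgnC1 j J : j \notin J -> sgn [set j] J = (-1) ^+ #|J| * sgn J [set j].
Proof.
move=> jJ; rewrite /sgn big_set1 -prodr_const -big_split /=.
apply: eq_bigr => i iJ; rewrite big_set1.
have : i != j by apply: contraNneq jJ => <-.
rewrite -val_eqE /=; case: ltngtP => //= _ _; first by rewrite mulr1.
by rewrite mulrNN mulr1.
Qed.

Lemma sgn11 l m : l != m -> sgn [set l] [set m] = - sgn [set m] [set l].
Proof. by move=> lm; rewrite sgnC1 ?inE// cards1 mulN1r. Qed.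

Definition step A B := (A \subset B) && (#|B| == #|A|.+1).

Lemma stepP A B : reflect (exists2 l, l \notin A & B = l |: A) (step A B).
Proof.
apply: (iffP andP) => [[AB /eqP cB]|[l lA ->]]; last first.
  by rewrite subsetUr cardsU1 lA.
have : #|B :\: A| == 1%N by rewrite cardsDS// cB subSnn.
case/cards1P => l BA; exists l.
  by move: (set11 l); rewrite -BA inE => /andP[].
by rewrite -BA setUC setDE setUIr setUCr setIT; apply/esym/setUidPr.
Qed.

Lemma step_add l A : l \notin A -> step A (l |: A).
Proof. by move=> lA; apply/stepP; exists l. Qed.

Lemma step_del l A : l \in A -> step (A :\ l) A.
Proof. by move=> lA; apply/stepP; exists l; rewrite ?setD11 ?setD1K. Qed.

Lemma step_sub A B : step A B -> A \subset B. Proof. by case/andP. Qed.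

Lemma step_irr A : step A A = false.
Proof. by rewrite /step -[X in X == _]addn0 -addn1 eqn_add2l andbF. Qed.

Lemma step2N A B X : step A X -> step X B -> step A B = false.
Proof.
case/andP => _ /eqP AX /andP[_ /eqP XB].
by rewrite /step XB AX eqSS -[X in _ == X]addn0 -addn1 eqn_add2l andbF.
Qed.

(** Exterior multiplication by the element that the step adds; this choice of
    signs makes every square anticommute, see [flip_sgn]. *)
Definition step_sgn A B : R := sgn (B :\: A) A.

Lemma setU1D l A : l \notin A -> (l |: A) :\: A = [set l].
Proof.
move=> lA; apply/setP => x; rewrite !inE; case: eqP => [->|_] /=.
  by rewrite lA.
by rewrite andNb.
Qed.

Lemma step_sgn_add l A : l \notin A -> step_sgn A (l |: A) = sgn [set l] A.
Proof. by move=> lA; rewrite /step_sgn setU1D. Qed.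

Lemma step_sgn_sq A B : step_sgn A B * step_sgn A B = 1.
Proof. exact: sgn_sq. Qed.

(** The other route from [A] to [B] around the square through [X]. *)
Definition flip A B X := A :|: (B :\: X).

Lemma squareP A B X : step A X -> step X B ->
  exists l m, [/\ l != m, l \notin A, m \notin A, X = l |: A
     & B = m |: (l |: A) /\ flip A B X = m |: A].
Proof.
move=> /stepP[l lA ->] /stepP[m mX ->].
have [ml mA] : m != l /\ m \notin A.
  by apply/andP; move: mX; rewrite !inE negb_or.
exists l, m; split => //; first by rewrite eq_sym.
by split=> //; rewrite /flip setU1D// setUC.
Qed.

Lemma flip_step A B X : step A X -> step X B ->
  [/\ step A (flip A B X), step (flip A B X) B, flip A B X != X
    & flip A B (flip A B X) = X].
Proof.
move=> AX XB; have [l [m [lm lA mA XE [BE ->]]]] := squareP AX XB.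
have lmA : l \notin m |: A by rewrite !inE negb_or lm.
have BE' : B = l |: (m |: A) by rewrite BE setUCA.
split.
- exact: step_add.
- by rewrite BE'; apply: step_add.
- by rewrite XE; apply: contraNneq lmA => ->; rewrite !inE eqxx.
- by rewrite /flip BE' setU1D// XE setUC.
Qed.

Lemma flip_sgn A B X : step A X -> step X B ->
  step_sgn A (flip A B X) * step_sgn (flip A B X) B =
  - (step_sgn A X * step_sgn X B).
Proof.
move=> AX XB; have [l [m [lm lA mA XE [BE ->]]]] := squareP AX XB.
have lmA : l \notin m |: A by rewrite !inE negb_or lm.
have mlA : m \notin l |: A by rewrite !inE negb_or eq_sym lm.
rewrite {1}BE setUCA XE BE !step_sgn_add// !sgnU1r// (sgn11 lm); ring.
Qed.

Lemma flip_uniq A B X Y : step A X -> step X B -> step A Y -> step Y B ->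
  Y = X \/ Y = flip A B X.
Proof.
move=> AX XB /stepP[k kA YE] YB.
have [l [m [lm lA mA XE [BE ->]]]] := squareP AX XB.
have : k \in B by apply: (subsetP (step_sub YB)); rewrite YE !inE eqxx.
by rewrite BE YE XE !inE (negPf kA) orbF => /orP[] /eqP ->; [right|left].
Qed.

End Signs.

(** * Coefficients of chains and of their boundaries *)

Section Coefficients.
Variables (R : realType) (G : digraph).
Implicit Types (q : nat).

(** Coefficients are extended by zero to irregular tuples, so that sums over
    regular paths become sums over all tuples. *)
Definition coef q (u : chain R G q) (t : q.-tuple G) : R :=
  if insub t is Some s then u s else 0.

Definition chain_of q (f : q.-tuple G -> R) : chain R G q :=
  [ffun s => f (val s)].

Lemma coef_val q (u : chain R G q) (s : rpath G q) : coef u (val s) = u s.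
Proof. by rewrite /coef valK. Qed.

Lemma coef_irregular q (u : chain R G q) t : ~~ regular t -> coef u t = 0.
Proof. by move=> irr; rewrite /coef insubN. Qed.

Lemma coefP q (u v : chain R G q) :
  (forall t, regular t -> coef u t = coef v t) -> u = v.
Proof.
by move=> uv; apply/ffunP => s; rewrite -!coef_val; apply/uv/(valP s).
Qed.

Lemma coef_chain_of q f (t : q.-tuple G) :
  regular t -> coef (chain_of f) t = f t.
Proof. by move=> rt; rewrite /coef insubT ffunE. Qed.

(** [coef] with the chain as last argument, to make it a linear function. *)
Definition coefl q (t : q.-tuple G) (u : chain R G q) : R^o := coef u t.

Fact coefl_linear q (t : q.-tuple G) : linear (coefl t).
Proof.
move=> a u v; rewrite /coefl /coef.
case: insubP => [s _ _|_]; first by rewrite !ffunE.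
by rewrite scaler0 addr0.
Qed.
HB.instance Definition _ q (t : q.-tuple G) :=
  GRing.isLinear.Build R (chain R G q) R^o _ (coefl t) (coefl_linear t).

Lemma coefZ q (t : q.-tuple G) a (u : chain R G q) :
  coef (a *: u) t = a * coef u t.
Proof. exact: (linearZ_LR (coefl t)). Qed.

Lemma coef_sum q (t : q.-tuple G) (I : Type) (r : seq I) (P : pred I)
    (F : I -> chain R G q) :
  coef (\sum_(i <- r | P i) F i) t = \sum_(i <- r | P i) coef (F i) t.
Proof. exact: (linear_sum (coefl t)). Qed.

Lemma coef_epath q (s t : q.-tuple G) :
  coef (epath R s) t = (regular t && (t == s))%:R.
Proof.
rewrite /coef; case: insubP => [r rt rE|/negPf -> //].
by rewrite ffunE rE rt.
Qed.

Lemma sum_rpath q (F : q.-tuple G -> R) :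
  (forall t, ~~ regular t -> F t = 0) ->
  \sum_(s : rpath G q) F (val s) = \sum_t F t.
Proof.
move=> F0; rewrite (bigID (@regular G q)) /= [X in _ = _ + X]big1 ?addr0 //.
by rewrite -(big_sub (@regular G q)).
Qed.

Lemma dotp_coef q (u v : chain R G q) :
  dotp u v = \sum_t coef u t * coef v t.
Proof.
rewrite -(@sum_rpath _ (fun t => coef u t * coef v t)) => [|t irr].
  by apply: eq_bigr => s _; rewrite !coef_val.
by rewrite coef_irregular ?mul0r.
Qed.

Definition ins q (k : 'I_q.+1) (x : G) (s : q.-tuple G) : q.+1.-tuple G :=
  [tuple if unlift k i is Some j then tnth s j else x | i < q.+1].

Lemma val_ins q (k : 'I_q.+1) x (s : q.-tuple G) :
  tval (ins k x s) = take k s ++ x :: drop k s.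
Proof.
have kq : (k <= q)%N by rewrite -ltnS.
have sT : size (take k s) = k by rewrite size_takel ?size_tuple.
apply: (@eq_from_nth _ x) => [|i].
  by rewrite size_tuple size_cat sT /= size_drop size_tuple addnS subnKC.
rewrite size_tuple => iq; rewrite -[i]/(val (Ordinal iq)) -tnth_nth tnth_mktuple.
rewrite nth_cat sT; case: unliftP => [j ->|->] /=; last by rewrite ltnn subnn.
rewrite /bump (tnth_nth x); case: (leqP k j) => [kj|jk] /=.
  by rewrite ltnNge (leqW kj) /= subSn //= nth_drop subnKC.
by rewrite jk nth_take.
Qed.

Lemma face_ins q (k : 'I_q.+1) x (s : q.-tuple G) : face k (ins k x s) = s.
Proof. by apply: eq_from_tnth => i; rewrite !tnth_mktuple liftK. Qed.

Lemma ins_face q (k : 'I_q.+1) (t : q.+1.-tuple G) :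
  ins k (tnth t k) (face k t) = t.
Proof.
apply: eq_from_tnth => i; rewrite !tnth_mktuple.
by case: unliftP => [j ->|-> //]; rewrite tnth_mktuple.
Qed.

Lemma tnth_ins q (k : 'I_q.+1) x (s : q.-tuple G) : tnth (ins k x s) k = x.
Proof. by rewrite tnth_mktuple unlift_none. Qed.

(** The paths with a given [k]-th face arise from it by inserting an arbitrary
    vertex at the place [k]. *)
Lemma coef_bdry q (u : chain R G q.+1) (s : q.-tuple G) : regular s ->
  coef (bdry R G q u) s =
  \sum_(k < q.+1) (-1) ^+ k * \sum_(x : G) coef u (ins k x s).
Proof.
move=> rs; rewrite lfunE /= /bdry_fun coef_sum.
transitivity (\sum_(t : rpath G q.+1) \sum_(k < q.+1)
    (-1) ^+ k * (coef u (val t) * (s == face k (val t))%:R)).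
  apply: eq_bigr => t _; rewrite coefZ /bdry_path coef_sum mulr_sumr.
  by apply: eq_bigr => k _; rewrite coefZ coef_epath rs mulrCA coef_val.
rewrite exchange_big /=; apply: eq_bigr => k _.
rewrite -mulr_sumr; congr (_ * _).
rewrite (@sum_rpath _ (fun t => coef u t * (s == face k t)%:R)) => [|t irr];
  last by rewrite coef_irregular ?mul0r.
rewrite (bigID (fun t => s == face k t)) /= [X in _ + X]big1 ?addr0; last first.
  by move=> t /negPf ->; rewrite mulr0.
rewrite (reindex_onto (fun x => ins k x s) (fun t => tnth t k)) /=; last first.
  by move=> t /eqP {1}->; rewrite ins_face.
by apply: eq_big => x; rewrite face_ins ?tnth_ins ?eqxx// mulr1.
Qed.

Lemma allowed_regular q (t : q.+1.-tuple G) :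
  sorted (@arrow G) t -> regular t.
Proof.
move=> st; apply: sub_sorted st => x y xy.
by apply: contraTneq xy => ->; rewrite arrow_irr.
Qed.

Lemma coef_allowed q (u : chain R G q) (t : q.-tuple G) :
  u \in allowed R G q -> ~~ sorted (@arrow G) t -> coef u t = 0.
Proof.
move=> uA nt; set L := [seq epath R t | t <- allowed_path G q].
rewrite (@coord_span _ _ _ (in_tuple L) u uA) coef_sum big1// => i _.
have : (in_tuple L)`_i \in L by apply: mem_nth.
rewrite coefZ => /mapP[s]; rewrite mem_filter => /andP[ss _] ->.
rewrite coef_epath; case: eqP => [ts|_]; first by rewrite ts ss in nt.
by rewrite andbF mulr0.
Qed.

Lemma chain_epath q (u : chain R G q) :
  u = \sum_t coef u t *: epath R t.
Proof.
apply: coefP => t rt; rewrite coef_sum (bigD1 t)//= big1 => [|s].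
  by rewrite coefZ coef_epath rt eqxx mulr1 addr0.
by rewrite coefZ coef_epath eq_sym => /negPf ->; rewrite andbF mulr0.
Qed.

Lemma allowedP q (u : chain R G q) :
  (forall t : q.-tuple G,
     regular t -> ~~ sorted (@arrow G) t -> coef u t = 0) ->
  u \in allowed R G q.
Proof.
move=> u0; rewrite (chain_epath u); apply: memv_suml => t _.
have [rt|irr] := boolP (regular t); last first.
  by rewrite coef_irregular// scale0r mem0v.
have [st|nt] := boolP (sorted (@arrow G) t); last first.
  by rewrite u0// scale0r mem0v.
apply/memvZ/memv_span/map_f.
by rewrite mem_filter st mem_enum.
Qed.

Lemma mem_Omega q (u : chain R G q.+1) :
  u \in Omega R G q.+1 =
  (u \in allowed R G q.+1) && (bdry R G q u \in allowed R G q).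
Proof. by rewrite memv_cap -memv_preim. Qed.

End Coefficients.

(** * Signed chains over the intervals of the Boolean lattice *)

Section ThetaValues.
Variables (R : realType) (n : nat).
Implicit Types (A B X : {set 'I_n}) (w s : seq {set 'I_n}).
Implicit Types (g : {set 'I_n} -> {set 'I_n} -> R).

Fixpoint path_sgn A w : R :=
  if w is B :: w' then step_sgn R A B * path_sgn B w' else 1.

Lemma path_sgn_cat A w1 w2 :
  path_sgn A (w1 ++ w2) = path_sgn A w1 * path_sgn (last A w1) w2.
Proof.
by elim: w1 A => [|B w IHw] A /=; rewrite ?mul1r// IHw mulrA.
Qed.

Lemma path_sgn_sq A w : path_sgn A w * path_sgn A w = 1.
Proof.
elim: w A => [|B w IHw] A /=; first by rewrite mulr1.
by rewrite mulrACA IHw mulr1 step_sgn_sq.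
Qed.

(** The coefficient on the path [s] of the chain that depends on the end points
    of [s] through [g], and on its order through the sign alone. *)
Definition theta_val g s : R :=
  if s is A :: w then
    if path (@step n) A w then g A (last A w) * path_sgn A w else 0
  else 0.

(** The two ways around a square carry opposite signs. *)
Lemma sum_theta_interior g A w1 B w2 :
  \sum_X theta_val g ((A :: w1) ++ X :: B :: w2) = 0.
Proof.
pose F X := theta_val g ((A :: w1) ++ X :: B :: w2); pose a := last A w1.
pose sw X := if step a X && step X B then flip a B X else X.
have swK : involutive sw.
  move=> X; rewrite /sw; case E: (step a X && step X B); last by rewrite E.
  case/andP: E => aX XB.
  by have [-> -> _ ->] := flip_step aX XB.
have Fsw X : F (sw X) = - F X.
  rewrite /F /theta_val /sw /= !cat_path !last_cat /= !path_sgn_cat -/a /=.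
  case E: (step a X && step X B); last first.
    by rewrite !(andbA (step a X) (step X B)) E andbF oppr0.
  case/andP: E => aX XB; have [aX' XB' _ _] := flip_step aX XB.
  rewrite aX XB aX' XB' /=; case: ifP => _; rewrite ?oppr0//.
  rewrite !(mulrA (step_sgn R a _)) flip_sgn//; ring.
have : \sum_X F X = - \sum_X F X.
  by rewrite {1}(reindex_inj (inv_inj swK)) -sumrN; apply: eq_bigr.
by move=> FN; lra.
Qed.

(** The action of the boundary on the values of a chain at the end points of
    its paths; it only moves one of the end points. *)
Definition end_bdry p g A B : R :=
  (\sum_(X | step X A) step_sgn R X A * g X B)
  + (-1) ^+ p * \sum_(X | step B X) step_sgn R B X * g A X.

Lemma theta_end_bdry p g A w :
  \sum_X theta_val g (X :: A :: w)
  + (-1) ^+ p * \sum_X theta_val g (rcons (A :: w) X) =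
  theta_val (end_bdry p g) (A :: w).
Proof.
rewrite /theta_val /end_bdry /=; case: ifP => pAw; last first.
  rewrite !big1 ?mulr0 ?addr0// => X _; last by rewrite andbF.
  by rewrite rcons_path pAw.
rewrite mulrDl -mulrA !mulr_suml; congr (_ + _ * _).
  rewrite [RHS]big_mkcond; apply: eq_bigr => X _.
  by rewrite andbT; case: ifP => // _; ring.
rewrite [RHS]big_mkcond; apply: eq_bigr => X _.
rewrite rcons_path pAw last_rcons -cats1 path_sgn_cat /=.
by case: ifP => // _; ring.
Qed.

End ThetaValues.

Section CubeChains.
Variables (R : realType) (n : nat) (G : digraph).
Variables (phi : G -> {set 'I_n}) (psi : {set 'I_n} -> G).
Hypotheses (phiK : cancel phi psi) (psiK : cancel psi phi).
Hypothesis arrowE : forall x y, arrow x y = step (phi x) (phi y).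
Implicit Types (A B X : {set 'I_n}) (w s : seq {set 'I_n}).
Implicit Types (g : {set 'I_n} -> {set 'I_n} -> R).

Definition theta p g : chain R G p.+1 :=
  chain_of (fun t : p.+1.-tuple G => theta_val g (map phi t)).

Lemma sorted_phi (s : seq G) :
  sorted (@arrow G) s = sorted (@step n) (map phi s).
Proof. by rewrite sorted_map; apply: eq_sorted => x y; rewrite arrowE. Qed.

Lemma theta_val_unsorted g s : ~~ sorted (@step n) s -> theta_val g s = 0.
Proof. by case: s => //= A w /negPf ->. Qed.

Lemma coef_theta p g (t : p.+1.-tuple G) :
  coef (theta p g) t = theta_val g (map phi t).
Proof.
have [rt|irr] := boolP (regular t); first by rewrite coef_chain_of.
rewrite coef_irregular// theta_val_unsorted// -sorted_phi.
by apply: contra irr; apply: allowed_regular.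
Qed.

Lemma theta_allowed p g : theta p g \in allowed R G p.+1.
Proof.
apply: allowedP => t _ nt.
by rewrite coef_theta theta_val_unsorted// -sorted_phi.
Qed.

Lemma sum_phi (F : {set 'I_n} -> R) : \sum_x F (phi x) = \sum_X F X.
Proof. by rewrite [RHS](reindex phi)//; exists psi => x _. Qed.

(** Interior vertices contribute nothing, by [sum_theta_interior]. *)
Lemma bdry_theta p g :
  bdry R G p.+1 (theta p.+1 g) = theta p (end_bdry p.+1 g).
Proof.
apply: coefP => t rt; rewrite coef_bdry// coef_theta.
have E k : \sum_x coef (theta p.+1 g) (ins k x t) =
    \sum_X theta_val g (take k (map phi t) ++ X :: drop k (map phi t)).
  rewrite -sum_phi; apply: eq_bigr => x _.
  by rewrite coef_theta val_ins map_cat /= map_take map_drop.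
under eq_bigr do rewrite E.
have : size (map phi t) = p.+1 by rewrite size_map size_tuple.
case: (map phi t) => [//|A w] sw.
rewrite big_ord_recl big_ord_recr /= [X in _ + (X + _)]big1 => [|i _]; last first.
  rewrite /bump /=.
  have iw : (i < size w)%N by case: sw => ->.
  by rewrite (drop_nth A iw) /= sum_theta_interior mulr0.
rewrite add0r expr0 mul1r -[RHS]/(theta_val (end_bdry p.+1 g) (A :: w)).
rewrite -theta_end_bdry; congr (_ + _ * _).
case: sw => sw; rewrite -sw take_size drop_size; apply: eq_bigr => X _.
by rewrite -cats1.
Qed.

(** The boundary is a chain of the same kind, hence made of allowed paths. *)
Lemma theta_Omega p g : theta p g \in Omega R G p.+1.
Proof.
rewrite mem_Omega theta_allowed /=; case: p g => [|p] g.
  by apply: allowedP => t /andP[].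
by rewrite bdry_theta theta_allowed.
Qed.

End CubeChains.

(** * Every element of Omega is a signed chain over intervals *)

Section Paths.
Variable n : nat.
Implicit Types (A B C X : {set 'I_n}) (w : seq {set 'I_n}) (l : seq 'I_n).

Lemma path_card A w : path (@step n) A w -> #|last A w| = (#|A| + size w)%N.
Proof.
elim: w A => [|X w IHw] A /=; first by rewrite addn0.
by case/andP => /andP[_ /eqP AX] /IHw ->; rewrite AX addSnnS.
Qed.

Lemma path_sub A w : path (@step n) A w -> A \subset last A w.
Proof.
elim: w A => [|X w IHw] A //= /andP[/step_sub AX /IHw]; exact: subset_trans.
Qed.

Definition add_path A l : seq {set 'I_n} := scanl (fun X i => i |: X) A l.

(** The chain that adds the missing elements in increasing order: it shows that
    every interval has a maximal chain, and singles out one of them. *)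
Definition std_path A B := add_path A (enum (B :\: A)).

Lemma add_pathP A l : uniq l -> [disjoint [set:: l] & A] ->
  path (@step n) A (add_path A l) /\ last A (add_path A l) = [set:: l] :|: A.
Proof.
elim: l A => [|i l IHl] A /=.
  by move=> _ _; split => //; apply/setP => x; rewrite !inE.
move=> /andP[il ul] dA; have iA : i \notin A.
  by rewrite -disjoints1 (disjointWl _ dA)// sub1set !inE eqxx.
have [|-> ->] := IHl (i |: A) ul.
  rewrite -setI_eq0 -subset0; apply/subsetP => x; rewrite !inE => /andP[xl].
  case/orP => [/eqP xi|xA]; first by rewrite -xi xl in il.
  by move/disjointFr: dA => /(_ x); rewrite !inE xl orbT xA => /(_ isT).
rewrite step_add//; split => //.
by apply/setP => x; rewrite !inE orbCA orbA.
Qed.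

Lemma std_pathP A B : A \subset B ->
  path (@step n) A (std_path A B) /\ last A (std_path A B) = B.
Proof.
move=> AB; have E : [set:: enum (B :\: A)] = B :\: A.
  by apply/setP => x; rewrite inE mem_enum.
have [|-> ->] := @add_pathP A (enum (B :\: A)) (enum_uniq _).
  by rewrite E -setI_eq0 setDE -setIA (setIC (~: A)) setICr setI0.
split => //; rewrite E; apply/setP => x; rewrite !inE.
by case: (boolP (x \in A)) => //= xA; rewrite ?orbF// (subsetP AB).
Qed.

(** Two paths with the same end points are related by flips: if their first
    steps differ, both first steps lie in the square that they span, and the
    rest of both paths may be taken through the top of that square. *)
Lemma path_flip_connected (T : Type) (f : seq {set 'I_n} -> T) A p :
  (forall w1 X B w2, path (@step n) A (w1 ++ X :: B :: w2) ->
     size (w1 ++ X :: B :: w2) = p ->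
     f (w1 ++ X :: B :: w2) = f (w1 ++ flip (last A w1) B X :: B :: w2)) ->
  forall w w', path (@step n) A w -> path (@step n) A w' ->
    last A w = last A w' -> size w = p -> f w = f w'.
Proof.
move=> flipf w w' pw pw' ww' sw.
suff H m u v v' : (size v <= m)%N -> path (@step n) A (u ++ v) ->
    path (@step n) A (u ++ v') -> last A (u ++ v) = last A (u ++ v') ->
    size (u ++ v) = p -> f (u ++ v) = f (u ++ v').
  exact: (H (size w) [::]).
elim: m u v v' => [|m IHm] u v v' sv pv pv' vv' suv;
  have svv : size v = size v' by
    have := path_card pv; rewrite vv' (path_card pv') !size_cat;
    move=> /addnI /addnI.
  by case: v v' svv sv {pv pv' vv' suv} => [|? ?] [].
case: v v' svv sv pv pv' vv' suv => [|X v] [|Y v'] //= [svv] sv.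
have [<-|XY] := eqVneq X Y.
  by rewrite -!cat_rcons; apply: IHm.
rewrite !cat_path !last_cat /= => /and3P[pu aX pX] /and3P[_ aY pY] vv' suv.
set a := last A u in aX aY *; have [i ia XE] := stepP _ _ aX.
have [j ja YE] := stepP _ _ aY; have ij : i != j.
  by apply: contraNneq XY => ij; rewrite XE YE ij.
pose Z := j |: X.
have jX : j \notin X by rewrite XE !inE negb_or eq_sym ij.
have XZ : step X Z by apply: step_add.
have ZE : flip a Z X = Y by rewrite /flip setU1D// YE setUC.
have [_ YZ _ _] := flip_step aX XZ; rewrite ZE in YZ.
have ZC : Z \subset last X v.
  rewrite subUset (path_sub pX) andbT vv'.
  by apply: subset_trans (path_sub pY); rewrite YE subsetUl.
have [pZ lZ] := std_pathP ZC; set z := std_path _ _ in pZ lZ.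
have sz : size v = (size z).+1.
  have := path_card pX; rewrite -lZ (path_card pZ).
  by case/andP: XZ => _ /eqP ->; rewrite addSnnS => /addnI.
have pZz : path (@step n) A (u ++ X :: Z :: z) by rewrite cat_path /= pu aX XZ.
have pYz : path (@step n) A (u ++ Y :: Z :: z) by rewrite cat_path /= pu aY YZ.
have sX : size (u ++ X :: Z :: z) = p by rewrite -suv !size_cat /= sz.
have sY : size (u ++ Y :: Z :: z) = p by rewrite -suv !size_cat /= sz.
transitivity (f (u ++ X :: Z :: z)).
  have := IHm (rcons u X) v (Z :: z); rewrite !cat_rcons; apply => //.
    by rewrite cat_path /= pu aX.
  by rewrite !last_cat /= lZ.
rewrite flipf// -/a ZE.
have := IHm (rcons u Y) (Z :: z) v'; rewrite !cat_rcons; apply => //.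
- by rewrite /= -sz.
- by rewrite cat_path /= pu aY.
- by rewrite !last_cat /= lZ.
Qed.

End Paths.

Section OmegaTheta.
Variables (R : realType) (n : nat) (G : digraph).
Variables (phi : G -> {set 'I_n}) (psi : {set 'I_n} -> G).
Hypotheses (phiK : cancel phi psi) (psiK : cancel psi phi).
Hypothesis arrowE : forall x y, arrow x y = step (phi x) (phi y).
Implicit Types (A B X : {set 'I_n}) (w s : seq {set 'I_n}).

Definition seq_coef q (u : chain R G q) (s : seq {set 'I_n}) : R :=
  if insub (map psi s) is Some t then coef u t else 0.

Lemma seq_coef_map q (u : chain R G q) (t : q.-tuple G) :
  seq_coef u (map phi t) = coef u t.
Proof. by rewrite /seq_coef mapK// valK. Qed.

Lemma map_psi_tuple q s (ss : size s = q) :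
  exists t : q.-tuple G, map phi t = s.
Proof.
have st : size (map psi s) == q by rewrite size_map ss.
by exists (Tuple st); rewrite /= mapK.
Qed.

(** Removing [X] leaves a path that is not allowed, and only the two sides of the
    square fill the gap; as the boundary has no term on that path, their
    coefficients are opposite. *)
Lemma Omega_flip p (u : chain R G p.+1) A w1 X B w2 :
  u \in Omega R G p.+1 -> path (@step n) A (w1 ++ X :: B :: w2) ->
  size (w1 ++ X :: B :: w2) = p ->
  seq_coef u (A :: w1 ++ flip (last A w1) B X :: B :: w2) =
  - seq_coef u (A :: w1 ++ X :: B :: w2).
Proof.
case: p u => [|r] u uO pAX; first by rewrite size_cat /= addnS.
move: (pAX); rewrite cat_path /= => /and4P[pA aX XB pB] sA.
set a := last A w1 in aX *; set X' := flip a B X.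
have [aX' XB' XX' _] := flip_step aX XB; rewrite -/X' in aX' XB' XX'.
have [t tE] : exists t : r.+1.-tuple G, map phi t = A :: w1 ++ B :: w2.
  by apply: map_psi_tuple; move: sA; rewrite /= !size_cat /= !addnS.
have st : size (A :: w1 ++ B :: w2) = r.+1 by rewrite -tE size_map size_tuple.
have rt : regular t.
  rewrite /regular /= -(mapK phiK t) sorted_map tE.
  rewrite /= cat_path /= -/a.
  have stepN : subrel (@step n) (relpre psi (fun x y => x != y)).
    move=> C D /= CD; rewrite (can_eq psiK).
    by apply: contraTneq CD => ->; rewrite step_irr.
  rewrite (sub_path stepN pA) (sub_path stepN pB) andbT /= (can_eq psiK).
  apply: contraTneq (step_sub aX) => ->; apply/negP => BX.
  have := subset_leq_card BX; case/andP: XB => _ /eqP ->.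
  by rewrite ltnn.
have nt : ~~ sorted (@arrow G) t.
  by rewrite (sorted_phi arrowE) tE /= cat_path /= -/a (step2N aX XB) andbF.
move: uO; rewrite mem_Omega => /andP[uA /coef_allowed/(_ nt)].
rewrite coef_bdry//.
have kr : ((size w1).+1 < r.+2)%N.
  by move: st; rewrite /= size_cat addnS => -[<-]; rewrite !ltnS leqW ?leq_addr.
pose k0 := Ordinal kr.
have insE k x : map phi (ins k x t) =
    take k (A :: w1 ++ B :: w2) ++ phi x :: drop k (A :: w1 ++ B :: w2).
  by rewrite val_ins map_cat /= map_take map_drop tE.
have insk0 x : map phi (ins k0 x t) = A :: w1 ++ phi x :: B :: w2.
  rewrite insE -cat_cons take_size_cat// drop_size_cat//.
rewrite (bigD1 k0)//= [X in _ + X]big1 ?addr0 => [|k kk0]; last first.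
  rewrite big1 ?mulr0// => x _; apply: (coef_allowed uA).
  rewrite (sorted_phi arrowE) insE.
  (* Inserted elsewhere, a vertex leaves the forbidden pair [a], [B] adjacent. *)
  apply/negP; have : (k <= size w1)%N || (size w1 + 2 <= k)%N.
    by move: kk0; rewrite -val_eqE /= neq_ltn ltnS addn2.
  case/orP => kw.
    rewrite -cat_cons drop_cat /= ltnS kw => /cat_sorted2[_] /=.
    rewrite cat_path => /andP[_ /=].
    have -> : last (phi x) (drop k (A :: w1)) = a.
      have : size (drop k (A :: w1)) = (size w1 - k).+1.
        by rewrite size_drop subSn.
      have : last (phi x) (take k (A :: w1) ++ drop k (A :: w1)) = a.
        by rewrite cat_take_drop.
      by rewrite last_cat; case: (drop k (A :: w1)).
    by rewrite (step2N aX XB).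
  rewrite -cat_rcons -cat_cons take_cat /= size_rcons.
  have -> : (k < (size w1).+2)%N = false by rewrite ltnNge -addn2 kw.
  rewrite /= -catA cat_path => /andP[+ _].
  by rewrite rcons_path -/a (step2N aX XB) andbF.
move/eqP; rewrite mulf_eq0 signr_eq0 /= => /eqP s0.
have {}s0 : \sum_Y seq_coef u (A :: w1 ++ Y :: B :: w2) = 0.
  rewrite -(sum_phi phiK psiK) -[RHS]s0; apply: eq_bigr => x _.
  by rewrite -insk0 seq_coef_map.
apply/eqP; rewrite -addr_eq0 -s0 (bigD1 X')//= (bigD1 X) 1?eq_sym//= addrA.
rewrite big1 ?addr0// => Y /andP[YX' YX].
have [t' t'E] : exists t : r.+2.-tuple G, map phi t = A :: w1 ++ Y :: B :: w2.
  by apply: map_psi_tuple; rewrite /= -sA !size_cat.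
rewrite -t'E seq_coef_map; apply: (coef_allowed uA).
rewrite (sorted_phi arrowE) t'E /= cat_path /= -/a pA pB andbT /=.
apply/negP => /andP[aY YB].
by case: (flip_uniq aX XB aY YB) => YE; rewrite YE eqxx in YX YX'.
Qed.

Definition end_val p (u : chain R G p.+1) A B : R :=
  path_sgn R A (std_path A B) * seq_coef u (A :: std_path A B).

(** Multiplied by the sign of the path, the coefficients are invariant under
    flips, so they depend only on the end points. *)
Lemma Omega_theta p (u : chain R G p.+1) :
  u \in Omega R G p.+1 -> u = theta phi p (end_val u).
Proof.
move=> uO; apply: coefP => t rt; rewrite (coef_theta arrowE).
have [st|nt] := boolP (sorted (@arrow G) t); last first.
  rewrite theta_val_unsorted -?(sorted_phi arrowE)//.
  by move: uO nt; rewrite mem_Omega => /andP[/coef_allowed uA _]; apply: uA.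
move: st; rewrite (sorted_phi arrowE) -seq_coef_map.
have : size (map phi t) = p.+1 by rewrite size_map size_tuple.
case: (map phi t) => [//|A w] [sw] /= pw; rewrite pw.
have [pz lz] := std_pathP (path_sub pw).
pose f w := path_sgn R A w * seq_coef u (A :: w).
rewrite /end_val -/(f _) -(@path_flip_connected _ _ f A p _ w) //.
  by rewrite /f mulrAC path_sgn_sq mul1r.
move=> w1 X B w2 pAX sAX; rewrite /f (Omega_flip uO)// !path_sgn_cat /=.
move: pAX; rewrite cat_path /= => /and4P[_ aX XB _].
by rewrite !(mulrA (step_sgn R (last A w1) _)) flip_sgn//; ring.
Qed.

End OmegaTheta.

(** * Chains carrying characters *)

Section CubeValues.
Variables (R : realType) (n : nat).
Implicit Types (A B J K X : {set 'I_n}) (i j l : 'I_n).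

Lemma disjU1 j A B : [disjoint j |: A & B] = (j \notin B) && [disjoint A & B].
Proof. by rewrite -!setI_eq0 setIUl setU_eq0 !setI_eq0 disjoints1. Qed.

(** The characters of the group of subsets under symmetric difference. *)
Definition chi K A : R := \prod_(x in A) (if x \in K then -1 else 1).

Lemma chiU1 K l A : l \in K -> l \notin A -> chi K (l |: A) = - chi K A.
Proof. by move=> lK lA; rewrite /chi big_setU1//= lK mulN1r. Qed.

(** Summing a product of factors over all sets is multiplying out; one factor
    vanishes as soon as the two characters differ. *)
Lemma chi_ortho K K' J : J \subset K -> J \subset K' ->
  \sum_(A : {set 'I_n} | [disjoint A & J]) chi K A * chi K' A =
  if K == K' then (2 ^ (n - #|J|))%:R else 0.
Proof.
move=> JK JK'; pose c x : R :=
  (if x \in K then -1 else 1) * (if x \in K' then -1 else 1).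
pose F x := if x \in J then 0 else c x.
transitivity (\prod_(x : 'I_n) (F x + 1)).
  rewrite bigA_distr [RHS](bigID (fun A : {set 'I_n} => [disjoint A & J])) /=.
  rewrite [X in _ + X]big1 ?addr0 => [|A].
    apply: eq_big => [A //|A dA].
    rewrite -big_split -big_mkcond /=; apply: eq_bigr => x xA.
    by rewrite /F (disjointFr dA xA).
  rewrite -setI_eq0 /= => /set0Pn[x]; rewrite inE => /andP[xA xJ].
  by rewrite (bigD1 x)//= xA /F xJ mul0r.
have [KK'|KK'] := eqVneq K K'.
  rewrite (bigID (mem J)) /= big1 ?mul1r => [|x xJ]; last by rewrite /F xJ add0r.
  rewrite (eq_bigr (fun=> 2)) => [|x xJ]; last first.
    by rewrite /F (negPf xJ) /c -KK'; case: ifP; rewrite ?mulrNN mulr1.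
  rewrite prodr_const natrX; congr (_ ^+ _).
  have <- : #|~: J| = (n - #|J|)%N by rewrite cardsCs setCK card_ord.
  by apply: eq_card => x; rewrite !inE.
have [x xKK'] : exists x, (x \in K) != (x \in K').
  apply/existsP; rewrite -negb_forall; apply: contra KK' => /forallP E.
  by apply/eqP/setP => x; apply/eqP/E.
rewrite (bigD1 x)//= /F /c ifN.
  by case: (x \in K) xKK'; case: (x \in K') => //= _;
     rewrite ?mulr1 ?mul1r addNr mul0r.
by apply: contra xKK' => xJ; rewrite (subsetP JK) ?(subsetP JK').
Qed.

(** The chain with these values is the sum of all faces with directions [J], each
    weighted by the character [K] at its first vertex.  The factor [sgn R J A]
    cancels the dependence of [path_sgn] on the first vertex, so that parallel
    faces are oriented alike. *)
Definition cube_val K J A B : R :=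
  if [disjoint A & J] && (B == A :|: J) then chi K A * sgn R J A else 0.

Lemma big_step_to (F : {set 'I_n} -> R) A :
  \sum_(X | step X A) F X = \sum_(j in A) F (A :\ j).
Proof.
rewrite -[RHS](big_imset F) /=; last first.
  move=> i j iA jA /setP/(_ i); rewrite !inE eqxx iA /= andbT.
  by move/esym/negbFE/eqP.
apply: eq_bigl => X; apply/idP/imsetP => [/stepP[l lX ->]|[j jA ->]].
  by exists l; rewrite ?setU11 ?setU1K.
exact: step_del.
Qed.

Lemma big_step_from (F : {set 'I_n} -> R) B :
  \sum_(X | step B X) F X = \sum_(j | j \notin B) F (j |: B).
Proof.
rewrite -[RHS](big_imset F) /=; last first.
  move=> i j iB jB /setP/(_ i); rewrite !inE eqxx /=.
  by move/esym; rewrite -topredE /= in iB; rewrite (negPf iB) orbF => /eqP.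
apply: eq_bigl => X; apply/idP/imsetP => [/stepP[l lB ->]|[j jB ->]].
  by exists l.
exact: step_add.
Qed.

Lemma cube_val_start K J j A B : j \in K -> j \notin J -> j \notin A ->
  sgn R [set j] A * cube_val K (j |: J) A B =
  - (sgn R J [set j] * cube_val K J (j |: A) B).
Proof.
move=> jK jJ jA; rewrite /cube_val disjU1 jJ disjoint_sym disjU1 jA /=.
rewrite disjoint_sym setUCA setUA; case: ifP => _; last by rewrite !mulr0 oppr0.
rewrite chiU1// sgnU1// sgnU1r//.
have -> : sgn R [set j] A * (chi K A * (sgn R [set j] A * sgn R J A)) =
  sgn R [set j] A * sgn R [set j] A * (chi K A * sgn R J A) by ring.
have -> : - (sgn R J [set j] * (- chi K A * (sgn R J [set j] * sgn R J A))) =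
  sgn R J [set j] * sgn R J [set j] * (chi K A * sgn R J A) by ring.
by rewrite !sgn_sq.
Qed.

Lemma cube_val_end K J j A B : j \notin J -> j \notin A -> j \notin B ->
  (-1) ^+ #|j |: J| * (sgn R [set j] B * cube_val K (j |: J) A (j |: B)) =
  - (sgn R J [set j] * cube_val K J A B).
Proof.
move=> jJ jA jB; rewrite /cube_val disjoint_sym disjU1 jA /= disjoint_sym.
have -> : (j |: B == A :|: (j |: J)) = (B == A :|: J).
  rewrite setUCA; apply/eqP/eqP => [/(congr1 (fun X => X :\ j))|->//].
  by rewrite !setU1K// inE negb_or jA.
case: ifP => [/andP[dAJ /eqP ->]|_]; last by rewrite !mulr0 oppr0.
rewrite sgnUr// sgnU1// cardsU1 jJ exprS mulN1r (sgnC1 R jJ).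
have -> : - (-1) ^+ #|J| * (sgn R [set j] A * ((-1) ^+ #|J| * sgn R J [set j]) *
    (chi K A * (sgn R [set j] A * sgn R J A))) =
  - ((sgn R [set j] A * sgn R [set j] A) * ((-1) ^+ #|J| * (-1) ^+ #|J|)
   * (sgn R J [set j] * (chi K A * sgn R J A))) by ring.
by rewrite sgn_sq -expr2 sqrr_sign !mul1r.
Qed.

(** The direction [j] of a face is lost by prolonging a path at its start, or
    at its end; both cases contribute the same sign. *)
Lemma end_bdry_cube K J A B : J \subset K -> A \subset B ->
  end_bdry #|J| (cube_val K J) A B =
  - \sum_(j in J) sgn R (J :\ j) [set j] * cube_val K (J :\ j) A B.
Proof.
move=> JK AB; rewrite /end_bdry big_step_to big_step_from.
rewrite mulr_sumr [in LHS]big_mkcond [X in _ + X]big_mkcond -big_split /=.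
rewrite [in RHS]big_mkcond -sumrN; apply: eq_bigr => j _.
case: (boolP (j \in A)) => jA.
  have jB := subsetP AB _ jA; rewrite jB /= addr0.
  have jA' : j \notin A :\ j by rewrite setD11.
  have [jJ|jJ] := boolP (j \in J); last first.
    rewrite /cube_val; case: ifP => [/andP[_ /eqP BE]|]; rewrite ?mulr0 ?oppr0//.
    by move: jB; rewrite BE !inE eqxx (negPf jJ).
  have jJ' : j \notin J :\ j by rewrite setD11.
  have := cube_val_start B (subsetP JK _ jJ) jJ' jA'.
  by rewrite -step_sgn_add// !setD1K.
rewrite add0r; case: (boolP (j \in B)) => jB /=.
  case: ifP => jJ; rewrite ?oppr0// /cube_val; case: ifP => [/andP[_ /eqP BE]|].
    by move: jB; rewrite BE !inE eqxx (negPf jA).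
  by rewrite mulr0 oppr0.
have [jJ|jJ] := boolP (j \in J); last first.
  rewrite /cube_val; case: ifP => [/andP[_ /eqP BE]|]; rewrite ?mulr0 ?oppr0//.
  have : j \in A :|: J by rewrite -BE setU11.
  by rewrite inE (negPf jA) (negPf jJ).
have jJ' : j \notin J :\ j by rewrite setD11.
have := cube_val_end K jJ' jA jB.
by rewrite !setD1K// step_sgn_add.
Qed.

End CubeValues.

(** * Free families and inner products *)

Section FreeFamilies.
Variables (K : fieldType) (V : vectType K) (I : finType).
Implicit Types (P : pred I) (e : I -> V).

Lemma free_family P e :
  (forall c : I -> K, \sum_(i | P i) c i *: e i = 0 ->
     forall i, P i -> c i = 0) ->
  free [seq e i | i in P].
Proof.
move=> e_free; set X := [seq e i | i in P].
have sX : size X = #|P| by rewrite size_map -cardE.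
pose T : #|P|.-tuple V := tcast sX (in_tuple X).
have TX : T = X :> seq V by rewrite val_tcast.
rewrite -TX; apply/freeP => k k0 i.
have Pi : enum_val i \in P := enum_valP i.
have : k (enum_rank_in Pi (enum_val i)) = 0.
  apply: (e_free (fun x => k (enum_rank_in Pi x))) => //.
  rewrite -[RHS]k0.
  rewrite [LHS](big_enum_val (A := P) (fun x => k (enum_rank_in Pi x) *: e x)).
  apply: eq_bigr => j _; rewrite enum_valK_in TX /X.
  by rewrite (nth_map (enum_val j)) -?cardE ?ltn_ord// -enum_val_nth.
by rewrite enum_valK_in.
Qed.

Lemma span_family P e :
  (<<[seq e i | i in P]>> = \sum_(i | P i) <[e i]>)%VS.
Proof. by rewrite span_def big_image. Qed.

Lemma mem_span_family P e v :
  v \in <<[seq e i | i in P]>>%VS ->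
  exists c : I -> K, v = \sum_(i | P i) c i *: e i.
Proof.
rewrite span_family => /memv_sumP[u uP ->].
have /fin_all_exists[c cP] i : exists k, P i -> u i = k *: e i.
  have [Pi|_] := boolP (P i); last by exists 0.
  by have /vlineP[k ->] := uP i Pi; exists k.
by exists c; apply: eq_bigr => i /cP.
Qed.

Lemma memv_span_family P e i : P i -> e i \in <<[seq e i | i in P]>>%VS.
Proof. by move=> Pi; apply/memv_span/image_f. Qed.

End FreeFamilies.

Section PathSums.
Variables (R : realType) (n : nat) (G : digraph).
Variables (phi : G -> {set 'I_n}) (psi : {set 'I_n} -> G).
Hypotheses (phiK : cancel phi psi) (psiK : cancel psi phi).
Hypothesis arrowE : forall x y, arrow x y = step (phi x) (phi y).
Implicit Types (A B J K X : {set 'I_n}).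
Implicit Types (g h : {set 'I_n} -> {set 'I_n} -> R).

Lemma sum_tuple_cons q (F : q.+1.-tuple G -> R) :
  \sum_t F t = \sum_x \sum_(t : q.-tuple G) F (cons_tuple x t).
Proof.
rewrite pair_big /= (reindex (fun xt => cons_tuple xt.1 xt.2)) //.
exists (fun t => (thead t, behead_tuple t)) => [[x t] _|t _] /=.
  by congr pair; apply: val_inj.
by rewrite [RHS]tuple_eta; apply: val_inj.
Qed.

(** By induction on the first step, for which an interval of length [p] leaves
    [p] choices: each interval of length [p] has [p!] maximal chains. *)
Lemma sum_paths p A (k : {set 'I_n} -> R) :
  \sum_(t : p.-tuple G)
     (if path (@step n) A (map phi t) then k (last A (map phi t)) else 0) =
  p`!%:R * \sum_(B : {set 'I_n} | (A \subset B) && (#|B| == #|A| + p)%N) k B.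
Proof.
elim: p A => [|p IHp] A.
  rewrite (big_pred1 [tuple]) => [|t]; last first.
    by apply/esym/eqP/val_inj; case: t => -[].
  rewrite (big_pred1 A) => [|B]; first by rewrite fact0 mul1r.
  rewrite addn0 /= [RHS]eq_sym eqEcard; case: (boolP (A \subset B)) => //= AB.
  by rewrite eqn_leq (subset_leq_card AB) andbT.
rewrite sum_tuple_cons (eq_bigr (fun x => if step A (phi x) then
  p`!%:R * \sum_(B : {set 'I_n} |
    (phi x \subset B) && (#|B| == #|phi x| + p)%N) k B
  else 0)) => [|x _]; last first.
  by rewrite /=; case: ifP => Ax /=; [rewrite -IHp|rewrite big1].
rewrite (sum_phi phiK psiK (fun X => if step A X then
  p`!%:R * \sum_(B : {set 'I_n} | (X \subset B) && (#|B| == #|X| + p)%N) k B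
  else 0)).
rewrite -big_mkcond /= big_step_from.
rewrite (eq_bigr (fun j => p`!%:R * \sum_(B : {set 'I_n} |
  (A \subset B) && (#|B| == #|A| + p.+1)%N) (j \in B)%:R * k B)) => [|j jA].
  rewrite -mulr_sumr exchange_big /= factS mulnC natrM -mulrA; congr (_ * _).
  rewrite mulr_sumr; apply: eq_bigr => B /andP[AB /eqP Bp].
  rewrite -mulr_suml; congr (_ * _).
  rewrite -natr_sum big_mkcond /= -[p.+1](addKn #|A|) -Bp -cardsDS// -sum1_card.
  congr (_%:R); rewrite [RHS]big_mkcond; apply: eq_bigr => j _.
  by rewrite inE; case: (j \in A) (j \in B) => [] [].
congr (_ * _); rewrite [RHS]big_mkcond [LHS]big_mkcond; apply: eq_bigr => B _.
rewrite subUset sub1set cardsU1 jA add1n addSnnS.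
by case: (j \in B); case: (A \subset B) => //=; case: ifP; rewrite ?mul1r ?mul0r.
Qed.

Lemma dotp_theta p g h :
  dotp (theta phi p g) (theta phi p h) =
  p`!%:R * \sum_(A : {set 'I_n})
    \sum_(B : {set 'I_n} | (A \subset B) && (#|B| == #|A| + p)%N)
     g A B * h A B.
Proof.
rewrite dotp_coef sum_tuple_cons mulr_sumr.
rewrite -(sum_phi phiK psiK (fun A => p`!%:R * \sum_(B : {set 'I_n} |
  (A \subset B) && (#|B| == #|A| + p)%N) g A B * h A B)).
apply: eq_bigr => x _; rewrite -sum_paths; apply: eq_bigr => t _.
rewrite !(coef_theta arrowE) /=; case: ifP => _; last by rewrite mul0r.
by rewrite mulrACA path_sgn_sq mulr1.
Qed.

Definition cube_chain p K J : chain R G p.+1 := theta phi p (cube_val R K J).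

Lemma dotp_cube_chain p K J K' J' :
  J \subset K -> #|J| = p -> J' \subset K' -> #|J'| = p ->
  dotp (cube_chain p K J) (cube_chain p K' J') =
  if (K == K') && (J == J') then (p`! * 2 ^ (n - p))%:R else 0.
Proof.
move=> JK Jp JK' Jp'; rewrite dotp_theta.
have E A : \sum_(B : {set 'I_n} | (A \subset B) && (#|B| == #|A| + p)%N)
     cube_val R K J A B * cube_val R K' J' A B =
    if (J == J') && [disjoint A & J] then chi R K A * chi R K' A else 0.
  case: (boolP [disjoint A & J]) => dAJ; last first.
    rewrite andbF big1// => B _.
    by rewrite /cube_val (negPf dAJ) mul0r.
  rewrite andbT (bigD1 (A :|: J)) /=; last first.
    by rewrite subsetUl cardsU disjoint_setI0// cards0 subn0 Jp eqxx.
  rewrite [X in _ + X]big1 ?addr0 => [|B /andP[_ /negPf BAJ]]; last first.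
    by rewrite /cube_val BAJ andbF mul0r.
  rewrite /cube_val dAJ eqxx /=; have [<-|JJ'] := eqVneq J J'.
    rewrite dAJ eqxx mulrACA sgn_sq mulr1 //.
  case: ifP => [/andP[dAJ' /eqP AJ]|]; rewrite ?mulr0//.
  case/eqP: JJ'; move: AJ => /(congr1 (fun X => X :\: A)).
  rewrite !setDUl setDv !set0U !(setDidPl _)// disjoint_sym//.
rewrite (eq_bigr _ (fun A _ => E A)).
case: (eqVneq J J') E => [JJ'|_] E /=; last by rewrite big1 ?mulr0 ?andbF.
have JK'' : J \subset K' by rewrite JJ'.
rewrite andbT -big_mkcond /= chi_ortho//.
by rewrite Jp; case: ifP => _; rewrite ?mulr0// -natrM.
Qed.

End PathSums.

(** * A basis of Omega and its Hodge operators *)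

Section AdjointTheory.
Variables (R : realType) (S T : finType).
Variables (U : {vspace {ffun S -> R^o}}) (W : {vspace {ffun T -> R^o}}).

Lemma adjointE (f : 'Hom(subvs_of U, subvs_of W)) y z :
  (forall x, dotp (vsval (f x)) (vsval y) = dotp (vsval x) (vsval z)) ->
  adjoint f y = z.
Proof.
move=> fz; apply/eqP; rewrite -subr_eq0; apply/eqP/val_inj/dotp_eq0.
have Z (x : subvs_of U) : dotp (vsval x) (vsval (adjoint f y - z)) = 0.
  by rewrite !linearB /= -(adjointP f) fz subrr.
exact: Z.
Qed.

End AdjointTheory.

Section CubeHodge.
Variables (R : realType) (n : nat) (G : digraph).
Variables (phi : G -> {set 'I_n}) (psi : {set 'I_n} -> G).
Hypotheses (phiK : cancel phi psi) (psiK : cancel psi phi).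
Hypothesis arrowE : forall x y, arrow x y = step (phi x) (phi y).
Implicit Types (A B J K X : {set 'I_n}) (F : {set 'I_n} * {set 'I_n}).
Implicit Types (g h : {set 'I_n} -> {set 'I_n} -> R).

Lemma theta_ext p g h : (forall A B, A \subset B -> g A B = h A B) ->
  theta phi p g = theta phi p h.
Proof.
move=> gh; apply: coefP => t _; rewrite !(coef_theta arrowE).
by case: (map phi t) => //= A w; case: ifP => // /path_sub/gh ->.
Qed.

Lemma theta_sum p (I : finType) (P : pred I) (c : I -> R)
    (g : I -> {set 'I_n} -> {set 'I_n} -> R) :
  theta phi p (fun A B => \sum_(i | P i) c i * g i A B) =
  \sum_(i | P i) c i *: theta phi p (g i).
Proof.
apply: coefP => t _; rewrite coef_sum (coef_theta arrowE).
under [RHS]eq_bigr do rewrite coefZ (coef_theta arrowE).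
case: (map phi t) => [|A w] /=; first by rewrite big1// => i _; rewrite mulr0.
case: ifP => _; last by rewrite big1// => i _; rewrite mulr0.
by rewrite mulr_suml; apply: eq_bigr => i _; rewrite mulrA.
Qed.

Lemma bdry_cube_chain p K J : J \subset K -> #|J| = p.+1 ->
  bdry R G p.+1 (cube_chain R phi p.+1 K J) =
  - \sum_(j in J) sgn R (J :\ j) [set j] *: cube_chain R phi p K (J :\ j).
Proof.
move=> JK Jp; rewrite (bdry_theta phiK psiK arrowE) -sumrN.
under eq_bigr do rewrite -scaleNr.
rewrite -theta_sum; apply: theta_ext => A B AB.
by rewrite -Jp end_bdry_cube// -sumrN; apply: eq_bigr => j _; rewrite mulNr.
Qed.

(** These pairs index two families: the faces, of which [K] is the last vertex
    and [J] the set of directions, and the characters [K] carried by the faces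
    with directions [J].  That both families have the same size is what makes
    the second one a basis of Omega. *)
Definition faces p : pred ({set 'I_n} * {set 'I_n}) :=
  fun F => (F.2 \subset F.1) && (#|F.2| == p).

Lemma free_cube_chain p :
  free [seq cube_chain R phi p F.1 F.2 | F in faces p].
Proof.
apply: free_family => c c0 F fF; have /andP[FK /eqP Fp] := fF.
have := congr1 (dotp (cube_chain R phi p F.1 F.2)) c0.
rewrite linear0 linear_sum /= (bigD1 F)//=.
rewrite big1 ?addr0 => [|F' /andP[/andP[FK' /eqP Fp'] FF']]; last first.
  rewrite linearZ /= (dotp_cube_chain R phiK psiK arrowE)// -xpair_eqE.
  by rewrite -!surjective_pairing eq_sym (negPf FF') scaler0.
rewrite linearZ /= (dotp_cube_chain R phiK psiK arrowE)// !eqxx /=.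
move/eqP; rewrite mulf_eq0 pnatr_eq0 muln_eq0 expn_eq0 /= orbF.
by rewrite -leqn0 leqNgt fact_gt0 orbF => /eqP.
Qed.

(** A chain in Omega is determined by one value for each interval of length [p],
    and these intervals are the faces. *)
Lemma dim_Omega_le p : (\dim (Omega R G p.+1) <= #|faces p|)%N.
Proof.
pose d F A B : R := ((A == F.1 :\: F.2) && (B == F.1))%:R.
pose X := [seq theta phi p (d F) | F in faces p].
have -> : #|faces p| = size X by rewrite size_map -cardE.
apply: leq_trans (dim_span X); apply/dimvS/subvP => u uO.
have -> : u = \sum_(F | faces p F)
    end_val psi u (F.1 :\: F.2) F.1 *: theta phi p (d F).
  rewrite {1}(Omega_theta phiK psiK arrowE uO) -theta_sum.
  apply: coefP => t _; rewrite !(coef_theta arrowE).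
  have : size (map phi t) = p.+1 by rewrite size_map size_tuple.
  case: (map phi t) => [//|A w] [sw] /=; case: ifP => // pw; congr (_ * _).
  have AB := path_sub pw; set B := last A w in AB *.
  have BA : B :\: (B :\: A) = A by rewrite setDDr setDv set0U; apply/setIidPr.
  rewrite (bigD1 (B, B :\: A)) /=; last first.
    rewrite /faces /= subsetDl cardsDS// (path_card pw) addKn sw eqxx //.
  rewrite /d /= BA !eqxx mulr1 big1 ?addr0// => -[K J] /andP[/andP[/= JK _] ne].
  rewrite /d /=; case: eqP => [AE|]; rewrite ?mulr0//.
  case: eqP => [BE|]; rewrite ?mulr0//.
  case/eqP: ne; rewrite BE AE setDDr setDv set0U.
  by congr pair; apply/esym/setIidPr.
by apply: memv_suml => F Fp; apply/memvZ/memv_span_family.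
Qed.

Lemma span_cube_chain p :
  <<[seq cube_chain R phi p F.1 F.2 | F in faces p]>>%VS = Omega R G p.+1.
Proof.
apply/eqP; rewrite eqEdim; apply/andP; split.
  apply/span_subvP => u /imageP[F _ ->]; exact: theta_Omega.
have /eqP -> := free_cube_chain p.
by rewrite size_map -cardE dim_Omega_le.
Qed.

Lemma dim_Omega p : \dim (Omega R G p.+1) = #|faces p|.
Proof.
rewrite -span_cube_chain; have /eqP -> := free_cube_chain p.
by rewrite size_map -cardE.
Qed.

Definition cube_form p K J : subvs_of (Omega R G p.+1) :=
  Subvs (theta_Omega phiK psiK arrowE p (cube_val R K J)).

Lemma cube_form_span p (x : subvs_of (Omega R G p.+1)) :
  exists c : _ -> R, x = \sum_(F | faces p F) c F *: cube_form p F.1 F.2.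
Proof.
have : vsval x \in <<[seq cube_chain R phi p F.1 F.2 | F in faces p]>>%VS.
  by rewrite span_cube_chain subvsP.
case/mem_span_family => c cE.
by exists c; apply: val_inj; rewrite /= cE linear_sum.
Qed.

Lemma dOmega_cube_form p K J : J \subset K -> #|J| = p.+1 ->
  dOmega R G p.+1 (cube_form p.+1 K J) =
  - \sum_(j in J) sgn R (J :\ j) [set j] *: cube_form p K (J :\ j).
Proof.
move=> JK Jp; apply: val_inj; rewrite /= dOmegaE bdry_cube_chain//.
by congr (- _); rewrite linear_sum.
Qed.

(** The factor [2 / p.+1] is the ratio of the square norms
    [p! 2 ^ (n - p)] of the chains in two consecutive dimensions. *)
Lemma adjoint_cube_form p K J : J \subset K -> #|J| = p ->
  adjoint (dOmega R G p.+1) (cube_form p K J) =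
  - (2 / p.+1%:R) *: \sum_(l in K :\: J)
      sgn R J [set l] *: cube_form p.+1 K (l |: J).
Proof.
move=> JK Jp; set z := _ *: _.
pose w : chain R G p.+2 := - ((2 / p.+1%:R) *: \sum_(l in K :\: J)
    sgn R J [set l] *: cube_chain R phi p.+1 K (l |: J)).
have zE : vsval z = w.
  by rewrite /z scaleNr; congr (- (_ *: _)); rewrite linear_sum.
suff key F : faces p.+1 F ->
    dotp (cube_chain R phi p K J)
      (vsval (dOmega R G p.+1 (cube_form p.+1 F.1 F.2)))
    = dotp w (cube_chain R phi p.+1 F.1 F.2).
  apply: adjointE => x; have [c ->] := cube_form_span x.
  transitivity (dotp w
    (vsval (\sum_(F | faces p.+1 F) c F *: cube_form p.+1 F.1 F.2))).
    rewrite dotpC !linear_sum /=.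
    by apply: eq_bigr => F /key kF; rewrite !linearZ /= kF.
  by rewrite dotpC -zE.
case: F => K' J' /andP[/= JK' /eqP Jp'].
rewrite dOmegaE bdry_cube_chain// [RHS]dotpC [LHS]linearN [RHS]linearN.
congr (- _); rewrite linear_sum [RHS]linearZ linear_sum /= scaler_sumr.
rewrite big_mkcond [RHS]big_mkcond; apply: eq_bigr => l _.
have J'l j : j \in J' -> J' :\ j \subset K' /\ #|J' :\ j| = p.
  move=> jJ'; rewrite (subset_trans (subsetDl _ _) JK'); split => //.
  by move: Jp'; rewrite (cardsD1 j J') jJ' => -[].
have Jl j : j \in K -> j \notin J -> j |: J \subset K /\ #|j |: J| = p.+1.
  by move=> jK jJ; rewrite subUset sub1set jK JK cardsU1 jJ Jp.
rewrite inE; have [/and3P[/eqP KK' /eqP JJ' lJ]|ne] :=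
  boolP [&& K == K', J' == l |: J & l \notin J].
  have lJ' : l \in J' by rewrite JJ' setU11.
  have lK : l \in K by rewrite KK' (subsetP JK').
  have [JK1 Jp1] := J'l l lJ'; have [JK2 Jp2] := Jl l lK lJ.
  rewrite lJ' lJ lK !linearZ /= !(dotp_cube_chain R phiK psiK arrowE)//.
  rewrite KK' JJ' setU1K// !eqxx /= /GRing.scale /=; congr (_ * _).
  have pn : (p < n)%N by rewrite -Jp2 -[n in (_ <= n)%N]card_ord max_card.
  rewrite factS -(subnSK pn) expnS !natrM.
  by field; rewrite addrC natr1 pnatr_eq0.
transitivity (0 : R).
  case: ifP => // lJ'; have [JK1 Jp1] := J'l l lJ'.
  rewrite linearZ /= (dotp_cube_chain R phiK psiK arrowE)//.
  rewrite ifN ?scaler0//; apply: contra ne => /andP[-> /eqP ->].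
  by rewrite setD1K// eqxx setD11.
case: ifP => // /andP[lJ lK]; have [JK2 Jp2] := Jl l lK lJ.
rewrite !linearZ /= (dotp_cube_chain R phiK psiK arrowE)//.
rewrite ifN ?scaler0//; apply: contra ne => /andP[/eqP <- ->].
by rewrite eqxx lJ.
Qed.

End CubeHodge.

Section HodgeIdentity.
Variables (R : realType) (n : nat) (G : digraph).
Variables (phi : G -> {set 'I_n}) (psi : {set 'I_n} -> G).
Hypotheses (phiK : cancel phi psi) (psiK : cancel psi phi).
Hypothesis arrowE : forall x y, arrow x y = step (phi x) (phi y).
Implicit Types (J K : {set 'I_n}) (F : {set 'I_n} * {set 'I_n}).

Local Notation form p K J := (@cube_form R n G phi psi phiK psiK arrowE p K J).
Local Notation d q := (dOmega R G q).
Local Notation ds q := (adjoint (dOmega R G q)).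

Lemma dOmega_dOmega q x : d q (d q.+1 x) = 0.
Proof. by apply: val_inj; rewrite /= !dOmegaE bdry_bdry. Qed.

Lemma adjoint_adjoint q x : ds q.+1 (ds q x) = 0.
Proof.
apply: adjointE => y.
by rewrite -(adjointP (d q)) dOmega_dOmega dotpC !linear0.
Qed.

Lemma setU1D1 (T : finType) (A : {set T}) i j :
  j != i -> (i |: A) :\ j = i |: A :\ j.
Proof.
move=> ji; apply/setP => x; rewrite !inE.
by case: (eqVneq x i) => //= ->; rewrite eq_sym ji.
Qed.

Lemma down_up p K J : J \subset K -> #|J| = p ->
  p.+1%:R *: d p.+1 (ds p.+1 (form p K J)) =
  2 *: \sum_(l in K :\: J) (form p K J + \sum_(j in J)
    (sgn R J [set l] * sgn R (l |: (J :\ j)) [set j])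
      *: form p K (l |: (J :\ j))).
Proof.
move=> JK Jp; rewrite adjoint_cube_form// linearZ linear_sum /= scalerA mulrN.
have -> : p.+1%:R * (2 / p.+1%:R) = 2 :> R.
  by field; rewrite addrC natr1 pnatr_eq0.
rewrite scaleNr -scalerN -sumrN; congr (_ *: _); apply: eq_bigr => l.
rewrite inE => /andP[lJ lK]; rewrite linearZ /= dOmega_cube_form ?cardsU1 ?lJ ?Jp//.
  rewrite scalerN opprK big_setU1//= scalerDr scalerA setU1K// sgn_sq scale1r.
  congr (_ + _); rewrite scaler_sumr; apply: eq_bigr => j jJ.
  have jl : j != l by apply: contraNneq lJ => <-.
  by rewrite scalerA setU1D1.
by rewrite subUset sub1set lK.
Qed.

Lemma up_down p K J : J \subset K -> #|J| = p ->
  p%:R *: ds p (d p (form p K J)) =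
  2 *: \sum_(l in K :\: J) \sum_(j in J)
    (sgn R (J :\ j) [set j] * sgn R (J :\ j) [set l])
      *: form p K (l |: (J :\ j))
  + (2 * p%:R) *: form p K J.
Proof.
move=> JK Jp; case: p Jp => [|p] Jp.
  rewrite (cards0_eq Jp) mulr0 !scale0r addr0 big1 ?scaler0// => l _.
  by rewrite big_set0.
rewrite dOmega_cube_form// linearN linear_sum /=.
rewrite (eq_bigr (fun j => - (2 / p.+1%:R) *: (form p.+1 K J +
  \sum_(l in K :\: J) (sgn R (J :\ j) [set j] * sgn R (J :\ j) [set l]) *:
    form p.+1 K (l |: (J :\ j))))) => [|j jJ].
  rewrite -scaler_sumr scalerN scalerA mulrN scaleNr opprK.
  have -> : p.+1%:R * (2 / p.+1%:R) = 2 :> R.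
    by field; rewrite addrC natr1 pnatr_eq0.
  rewrite big_split /= sumr_const Jp -scaler_nat scalerDr scalerA addrC.
  by rewrite exchange_big.
have Jj : #|J :\ j| = p by move: Jp; rewrite (cardsD1 j) jJ => -[].
rewrite linearZ /= adjoint_cube_form// ?(subset_trans (subsetDl _ _))//.
rewrite scalerA mulrC -scalerA; congr (_ *: _); rewrite scaler_sumr.
have KJ : K :\: (J :\ j) = j |: K :\: J.
  apply/setP => x; rewrite !inE; case: (eqVneq x j) => [->|] //=.
  by rewrite (subsetP JK).
rewrite KJ big_setU1 ?inE ?jJ//= scalerA sgn_sq scale1r setD1K//.
by congr (_ + _); apply: eq_bigr => l _; rewrite scalerA.
Qed.

(** The off-diagonal terms of the two compositions cancel, and each element of
    [K] contributes to exactly one diagonal: this is the exterior algebra of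
    the directions in [K]. *)
Lemma hodge_identity p K J : J \subset K -> #|J| = p ->
  p.+1%:R *: d p.+1 (ds p.+1 (form p K J)) + p%:R *: ds p (d p (form p K J)) =
  (2 * #|K|)%:R *: form p K J.
Proof.
move=> JK Jp; rewrite down_up// up_down// addrA -scalerDr -big_split /=.
rewrite (eq_bigr (fun=> form p K J)) => [|l]; last first.
  rewrite inE => /andP[lJ lK]; rewrite -addrA -big_split /= big1 ?addr0// => j jJ.
  rewrite -scalerDl; have jl : j != l by apply: contraNneq lJ => <-.
  have jJ' : j \notin J :\ j by rewrite setD11.
  have lJ' : l \notin J :\ j by rewrite !inE negb_and lJ orbT.
  rewrite -{1}(setD1K jJ) !sgnU1// (sgn11 R jl).
  have := sgn_sq R [set l] [set j].
  set a := sgn R [set l] [set j].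
  set b := sgn R (J :\ j) _; set c := sgn R (J :\ j) _.
  move=> aa; have -> : - a * b * (a * c) + c * b = (1 - a * a) * (b * c) by ring.
  by rewrite aa subrr mul0r scale0r.
rewrite sumr_const cardsDS// Jp -scaler_nat scalerA -scalerDl -mulrDr -natrD.
by rewrite subnK ?natrM// -Jp subset_leq_card.
Qed.

End HodgeIdentity.

(** * An eigenbasis of the Laplacian *)

Section SpecBasis.
Variables (R : realType) (V : vectType R) (I : finType).

(** The eigenvectors with eigenvalue [a] lie in the kernel of [f - a], the
    others in its image; as the dimensions of the kernel and of the image add
    up to that of the space, there is no room for more. *)
Lemma spec_eigenbasis (f : 'End(V)) (P : pred I) (e : I -> V) (lam : I -> R) :
  (forall i, P i -> f (e i) = lam i *: e i) ->
  (forall v, v \in <<[seq e i | i in P]>>%VS) ->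
  #|P| = \dim (fullv : {vspace V}) ->
  forall a, spec f a = #|[pred i | P i & lam i == a]|.
Proof.
move=> fe span_e cardP a; rewrite specE /passmx.leigenspace.
set g : 'End(V) := f - a *: \1%VF.
have ge i : P i -> g (e i) = (lam i - a) *: e i.
  by move=> Pi; rewrite !lfun_simp /= fe// scalerBl.
pose Pa := [pred i | P i & lam i == a]; pose Pn := [pred i | P i & lam i != a].
pose U := <<[seq e i | i in Pa]>>%VS; pose W := <<[seq e i | i in Pn]>>%VS.
have UL : (U <= lker g)%VS.
  apply/span_subvP => v /imageP[i /andP[Pi /eqP la] ->].
  by rewrite memv_ker ge// la subrr scale0r.
have WI : (W <= limg g)%VS.
  apply/span_subvP => v /imageP[i /andP[Pi la] ->].
  have -> : e i = g ((lam i - a)^-1 *: e i).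
    by rewrite linearZ /= ge// scalerA mulVf ?scale1r// subr_eq0.
  by rewrite memv_img// memvf.
have UW : (fullv <= U + W)%VS.
  apply/subvP => v _; have [c ->] := mem_span_family (span_e v).
  apply: memv_suml => i Pi; apply: memvZ.
  have [la|la] := boolP (lam i == a).
    by apply: (subvP (addvSl U W)); apply: memv_span_family; rewrite /= Pi.
  by apply: (subvP (addvSr U W)); apply: memv_span_family; rewrite /= Pi.
have card : (#|Pa| + #|Pn|)%N = #|P|.
  by rewrite -(cardID [pred i | lam i == a] P); congr (_ + _)%N;
     apply: eq_card => i; rewrite !inE -?topredE /= andbC.
have dU : (\dim U <= #|Pa|)%N.
  by rewrite (leq_trans (dim_span _))// size_map -cardE.
have dW : (\dim W <= #|Pn|)%N.
  by rewrite (leq_trans (dim_span _))// size_map -cardE.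
have dUW := leq_trans (dimvS UW) (dimv_add_leqif U W).
have dUL := dimvS UL; have dWI := dimvS WI.
have := limg_ker_dim g fullv; rewrite capfv => dg.
have squeeze (u w x y k l : nat) : (u <= x -> w <= y -> u <= k -> w <= l ->
    x + y <= u + w -> k + l = x + y -> k = x)%N by lia.
by apply: squeeze dU dW dUL dWI _ _; rewrite card cardP.
Qed.

End SpecBasis.

Section Eigenfamily.
Variables (R : realType) (n : nat) (G : digraph).
Variables (phi : G -> {set 'I_n}) (psi : {set 'I_n} -> G).
Hypotheses (phiK : cancel phi psi) (psiK : cancel psi phi).
Hypothesis arrowE : forall x y, arrow x y = step (phi x) (phi y).
Implicit Types (J K : {set 'I_n}) (F : {set 'I_n} * {set 'I_n}).

Local Notation form p K J := (@cube_form R n G phi psi phiK psiK arrowE p K J).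
Local Notation d q := (dOmega R G q).
Local Notation ds q := (adjoint (dOmega R G q)).

(** Applying the boundary to the Hodge identity kills one of its two terms. *)
Lemma Laplacian_exact r K J : J \subset K -> #|J| = r.+2 ->
  Laplacian R G r.+1 (d r.+2 (form r.+2 K J)) =
  ((2 * #|K|)%:R / r.+2%:R) *: d r.+2 (form r.+2 K J).
Proof.
move=> JK Jr; rewrite /Laplacian add_lfunE !comp_lfunE dOmega_dOmega linear0 addr0.
have /(congr1 (d r.+2)) := hodge_identity R phiK psiK arrowE JK Jr.
rewrite linearD !linearZ /= dOmega_dOmega scaler0 add0r => dE.
by rewrite mulrC -scalerA -dE scalerA mulVf ?scale1r ?pnatr_eq0.
Qed.

Lemma Laplacian_coexact r K J : J \subset K -> #|J| = r ->
  Laplacian R G r.+1 (ds r.+1 (form r K J)) =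
  ((2 * #|K|)%:R / r.+1%:R) *: ds r.+1 (form r K J).
Proof.
move=> JK Jr; rewrite /Laplacian add_lfunE !comp_lfunE adjoint_adjoint linear0 add0r.
have /(congr1 (ds r.+1)) := hodge_identity R phiK psiK arrowE JK Jr.
rewrite linearD !linearZ /= adjoint_adjoint scaler0 addr0 => dE.
by rewrite mulrC -scalerA -dE scalerA mulVf ?scale1r ?pnatr_eq0.
Qed.

(** For a fixed [K], the forms are the exterior algebra on the directions in
    [K], whose Koszul complex is exact.  A pivot direction in [K] selects bases
    of the boundaries and of the coboundaries. *)
Definition has_pivot F : bool :=
  if [pick i in F.1] is Some m then m \in F.2 else false.

Definition eigvec r F : subvs_of (Omega R G r.+2) :=
  if [pick i in F.1] is Some m then
    if m \in F.2 then ds r.+1 (form r F.1 (F.2 :\ m))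
    else d r.+2 (form r.+2 F.1 (m |: F.2))
  else 0.

Definition eigval r F : R :=
  (2 * #|F.1|)%:R / (if has_pivot F then r.+1 else r.+2)%:R.

Lemma eigvecP r F : faces r.+1 F ->
  Laplacian R G r.+1 (eigvec r F) = eigval r F *: eigvec r F.
Proof.
case: F => K J /andP[/= JK /eqP Jr]; rewrite /eigvec /eigval /has_pivot /=.
case: pickP => [m mK|_]; last by rewrite linear0 scaler0.
case: ifP => [mJ|/negbT mJ].
  apply: Laplacian_coexact; first by rewrite (subset_trans (subsetDl _ _)).
  by move: Jr; rewrite (cardsD1 m J) mJ => -[].
apply: Laplacian_exact; first by rewrite subUset sub1set mK.
by rewrite cardsU1 mJ Jr.
Qed.

Local Notation espan r := <<[seq eigvec r F | F in faces r.+1]>>%VS.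

Lemma eigvec_exact r K J m : [pick i in K] = Some m -> J \subset K ->
  #|J| = r.+2 -> m \in J -> d r.+2 (form r.+2 K J) \in espan r.
Proof.
move=> pK JK Jr mJ.
have -> : d r.+2 (form r.+2 K J) = eigvec r (K, J :\ m).
  by rewrite /eigvec /= pK setD11 setD1K.
apply: memv_span_family; rewrite /faces /= (subset_trans (subsetDl _ _))//=.
by move: Jr; rewrite (cardsD1 m J) mJ => -[/eqP].
Qed.

Lemma eigvec_coexact r K J m : [pick i in K] = Some m -> J \subset K ->
  #|J| = r -> m \notin J -> ds r.+1 (form r K J) \in espan r.
Proof.
move=> pK JK Jr mJ; have mK : m \in K by case: pickP pK => // i iK [<-].
have -> : ds r.+1 (form r K J) = eigvec r (K, m |: J).
  by rewrite /eigvec /= pK setU11 setU1K.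
apply: memv_span_family; rewrite /faces /= subUset sub1set mK JK /=.
by rewrite cardsU1 mJ Jr.
Qed.

(** If [J] avoids the pivot, add it: the boundary of the boundary of the larger
    form vanishes, and its terms other than the one of [J] contain the pivot. *)
Lemma exact_in_espan r K J m : [pick i in K] = Some m -> J \subset K ->
  #|J| = r.+2 -> d r.+2 (form r.+2 K J) \in espan r.
Proof.
move=> pK JK Jr; have [mJ|mJ] := boolP (m \in J); first exact: (eigvec_exact pK).
have mK : m \in K by case: pickP pK => // i iK [<-].
have mJK : m |: J \subset K by rewrite subUset sub1set mK.
have mJr : #|m |: J| = r.+3 by rewrite cardsU1 mJ Jr.
have := dOmega_dOmega (form r.+3 K (m |: J)).
rewrite dOmega_cube_form// linearN linear_sum big_setU1//= setU1K//.
move/eqP; rewrite oppr_eq0 linearZ addr_eq0 => /eqP dE.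
rewrite -[d _ _]scale1r -(sgn_sq R J [set m]) -scalerA dE.
apply/memvZ; rewrite memvN; apply: memv_suml => j jJ; rewrite linearZ; apply: memvZ.
have jm : j != m by apply: contraNneq mJ => <-.
apply: (eigvec_exact pK).
- exact: subset_trans (subsetDl _ _) mJK.
- by move: mJr; rewrite (cardsD1 j (m |: J)) !inE jJ orbT => -[].
- by rewrite !inE eqxx eq_sym jm.
Qed.

(** Dually, if [J] contains the pivot, remove it: the coboundary of the
    coboundary of the smaller form vanishes, and its terms other than the one of
    [J] avoid the pivot. *)
Lemma coexact_in_espan r K J m : [pick i in K] = Some m -> J \subset K ->
  #|J| = r -> ds r.+1 (form r K J) \in espan r.
Proof.
move=> pK JK Jr; have [mJ|mJ] := boolP (m \in J); last exact: (eigvec_coexact pK).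
have mK : m \in K by case: pickP pK => // i iK [<-].
case: r Jr => [|r] Jr; first by rewrite (cards0_eq Jr) inE in mJ.
have JmK : J :\ m \subset K by rewrite (subset_trans (subsetDl _ _)).
have Jmr : #|J :\ m| = r by move: Jr; rewrite (cardsD1 m J) mJ => -[].
have := adjoint_adjoint (form r K (J :\ m)).
rewrite adjoint_cube_form// linearZ linear_sum /= (bigD1 m) /=; last first.
  by rewrite !inE eqxx mK.
move/eqP; rewrite scaler_eq0 oppr_eq0 mulf_eq0 invr_eq0 !pnatr_eq0 /=.
rewrite setD1K// linearZ addr_eq0 => /eqP dE.
rewrite -[ds _ _]scale1r -(sgn_sq R (J :\ m) [set m]) -scalerA dE.
apply/memvZ; rewrite memvN; apply: memv_suml => l; rewrite !inE => /andP[].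
move=> /andP[lJ lK] lm; rewrite linearZ; apply: memvZ; rewrite lm /= in lJ.
apply: (eigvec_coexact pK).
- by rewrite subUset sub1set lK.
- by rewrite cardsU1 !inE lm lJ Jmr.
- by rewrite !inE eqxx eq_sym (negPf lm).
Qed.

Lemma espan_full r (v : subvs_of (Omega R G r.+2)) : v \in espan r.
Proof.
have [c ->] := cube_form_span phiK psiK arrowE v.
apply: memv_suml => -[K J] /andP[/= JK /eqP Jr]; apply: memvZ.
case pK : [pick i in K] => [m|]; last first.
  have K0 : K = set0 by apply/setP => i; rewrite inE; case: pickP pK.
  by move: JK Jr; rewrite K0 subset0 => /eqP ->; rewrite cards0.
have mK : m \in K by case: pickP pK => // i iK [<-].
have k0 : (2 * #|K|)%:R != 0 :> R.
  by rewrite pnatr_eq0 muln_eq0 /= cards_eq0; apply/set0Pn; exists m.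
rewrite -[form _ _ _]scale1r -(mulVf k0) -scalerA; apply: memvZ.
rewrite -(hodge_identity R phiK psiK arrowE JK Jr); apply: memvD; apply: memvZ.
  rewrite adjoint_cube_form// linearZ linear_sum; apply/memvZ/memv_suml => l.
  rewrite inE linearZ => /andP[lJ lK]; apply/memvZ/(exact_in_espan pK).
    by rewrite subUset sub1set lK.
  by rewrite cardsU1 lJ Jr.
rewrite dOmega_cube_form// linearN linear_sum memvN; apply: memv_suml => j jJ.
rewrite linearZ; apply/memvZ/(coexact_in_espan pK).
  exact: subset_trans (subsetDl _ _) JK.
by move: Jr; rewrite (cardsD1 j J) jJ => -[].
Qed.

Lemma spec_faces r a :
  spec (Laplacian R G r.+1) a =
  #|[pred F | faces r.+1 F & eigval r F == a]|.
Proof.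
apply: (@spec_eigenbasis _ _ _ _ _ (eigvec r)).
- by move=> F; apply: eigvecP.
- exact: espan_full.
by rewrite dimvf -(dim_Omega R phiK psiK arrowE).
Qed.

End Eigenfamily.

(** * Coordinates on the cube *)

Section ConsSet.
Variable n : nat.
Implicit Types (b : bool) (A : {set 'I_n}).

Definition cons_set b A : {set 'I_n.+1} :=
  [set x | if unlift ord0 x is Some i then i \in A else b].

Lemma in_cons_set0 b A : (ord0 \in cons_set b A) = b.
Proof. by rewrite inE unlift_none. Qed.

Lemma in_cons_setS b A i : (lift ord0 i \in cons_set b A) = (i \in A).
Proof. by rewrite inE liftK. Qed.

Lemma card_cons_set b A : #|cons_set b A| = (b + #|A|)%N.
Proof.
rewrite -!sum1_card !big_mkcond big_ord_recl /= in_cons_set0.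
congr (_ + _)%N; rewrite [RHS]big_mkcond.
by apply: eq_bigr => i _; rewrite in_cons_setS.
Qed.

Lemma cons_set_sub b A b' A' :
  (cons_set b A \subset cons_set b' A') = (b ==> b') && (A \subset A').
Proof.
apply/subsetP/andP => [s|[/implyP bb' /subsetP AA'] x].
  split; first by apply/implyP => b1; have := s ord0; rewrite !in_cons_set0; apply.
  by apply/subsetP => i iA; have := s (lift ord0 i); rewrite !in_cons_setS; apply.
by rewrite !inE; case: unliftP => [i _ /AA'|_ /bb'].
Qed.

Lemma step_cons_set b A b' A' :
  step (cons_set b A) (cons_set b' A') =
  ((b == b') && step A A') || (interval_arrow b b' && (A == A')).
Proof.
rewrite /step cons_set_sub !card_cons_set /interval_arrow.
case: b; case: b' => //=; rewrite ?add0n ?add1n ?eqSS ?andbF ?orbF//.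
rewrite eqEcard; case: (boolP (A \subset A')) => //= AA'.
by rewrite eqn_leq (subset_leq_card AA') andbT.
Qed.

End ConsSet.

Lemma cube_coordinates n : exists (phi : cube n -> {set 'I_n})
  (psi : {set 'I_n} -> cube n), [/\ cancel phi psi, cancel psi phi
    & forall x y, arrow x y = step (phi x) (phi y)].
Proof.
case: n => [|n].
  exists (fun=> set0), (fun=> tt); split => [[]//|A|x y].
    by apply/setP => -[].
  by rewrite step_irr.
elim: n => [|n [phi [psi [phiK psiK arrowE]]]].
  exists (fun b : bool => cons_set b set0 : {set 'I_1}),
    (fun A : {set 'I_1} => ord0 \in A).
  split => [b|A|x y]; first by rewrite in_cons_set0.
    by apply/setP => i; rewrite (ord1 i) in_cons_set0.
  by rewrite step_cons_set step_irr eqxx andbF andbT.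
pose phi' (u : bool * cube n.+1) := cons_set u.1 (phi u.2).
pose psi' (A : {set 'I_n.+2}) : bool * cube n.+1 :=
  (ord0 \in A, psi [set i | lift ord0 i \in A]).
exists phi', psi'; split => [[b x]|A|[b x] [b' x']].
- rewrite /psi' /phi' in_cons_set0; congr pair; rewrite -[RHS]phiK.
  by congr psi; apply/setP => i; rewrite inE in_cons_setS.
- apply/setP => i; rewrite /phi' /= psiK inE.
  by case: unliftP => [j ->|->]; rewrite ?inE.
by rewrite step_cons_set (can_eq phiK) -arrowE.
Qed.

(** * Counting the eigenvectors *)

Section Counting.
Variables (R : realType) (n : nat).
Implicit Types (J K : {set 'I_n}) (F : {set 'I_n} * {set 'I_n}) (a : R).

Lemma card_subsets_avoiding K m p : m \in K ->
  #|[pred J : {set 'I_n} | [&& J \subset K, #|J| == p & m \notin J]]|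
  = 'C(#|K|.-1, p).
Proof.
move=> mK; have -> : #|K|.-1 = #|K :\ m| by rewrite (cardsD1 m K) mK.
rewrite -cards_draws; apply: eq_card => J; rewrite !inE subsetD1.
by rewrite -andbA; congr (_ && _); rewrite andbC.
Qed.

Lemma card_subsets_through K m r : m \in K ->
  #|[pred J : {set 'I_n} | [&& J \subset K, #|J| == r.+1 & m \in J]]|
  = 'C(#|K|.-1, r).
Proof.
move=> mK; set x := #|[pred J | _]|.
have : (#|[pred J : {set 'I_n} |
      [&& J \subset K, #|J| == r.+1 & m \notin J]]| + x)%N = 'C(#|K|, r.+1).
  rewrite -cards_draws -[RHS](cardID [pred J : {set 'I_n} | m \notin J]).
  by congr (_ + _)%N; apply: eq_card => J; rewrite !inE /= ?negbK andbA andbC.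
rewrite card_subsets_avoiding// (cardsD1 m K) mK /= add1n binS.
by move/addnI.
Qed.

(** The multiplicity of [a] predicted for subsets [K] of cardinal [k], divided
    by the number of such subsets. *)
Definition mult r a k : nat :=
  ('C(k.-1, r) * (a == (2 * k)%:R / r.+1%:R)
   + 'C(k.-1, r.+1) * (a == (2 * k)%:R / r.+2%:R))%N.

(** The pivot of [K] is the same for all [J], so the faces over [K] split into
    the subsets through the pivot and those that avoid it. *)
Lemma card_faces_over r a K :
  #|[pred J | faces r.+1 (K, J) & eigval R r (K, J) == a]| =
  if (r < #|K|)%N then mult r a #|K| else 0%N.
Proof.
case pK : [pick i in K] => [m|]; last first.
  have -> : K = set0 by apply/setP => i; rewrite inE; case: pickP pK.
  rewrite cards0; apply: eq_card0 => J; rewrite !inE /= /faces /= subset0.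
  by case: eqP => //= ->; rewrite cards0.
have mK : m \in K by case: pickP pK => // i iK [<-].
rewrite -(cardID [pred J : {set 'I_n} | m \in J]) /mult.
have xN (P Q : pred {set 'I_n}) (b : bool) (k : nat) :
  #|P| = k -> (forall J, Q J = P J && b) -> #|Q| = (k * b)%N.
  move=> <- QE; case: b QE => QE; rewrite ?muln1 ?muln0.
    by apply: eq_card => J; rewrite -!topredE /= QE andbT.
  by apply: eq_card0 => J; rewrite -topredE /= QE andbF.
have EJ J : faces r.+1 (K, J) && (eigval R r (K, J) == a) =
  [&& J \subset K, #|J| == r.+1 &
      a == (2 * #|K|)%:R / (if m \in J then r.+1 else r.+2)%:R].
  by rewrite /faces /eigval /has_pivot /= pK -andbA (eq_sym a).
have -> : (#|[predI [pred J | faces r.+1 (K, J) & eigval R r (K, J) == a]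
    & [pred J : {set 'I_n} | m \in J]]| =
    'C(#|K|.-1, r) * (a == (2 * #|K|)%:R / r.+1%:R))%N.
  apply: (xN _ _ _ _ (card_subsets_through r mK)) => J /=; rewrite !inE /= EJ.
  by case: (m \in J); rewrite ?andbF ?andbT// andbA.
have -> : (#|[predD [pred J | faces r.+1 (K, J) & eigval R r (K, J) == a]
    & [pred J : {set 'I_n} | m \in J]]| =
    'C(#|K|.-1, r.+1) * (a == (2 * #|K|)%:R / r.+2%:R))%N.
  apply: (xN _ _ _ _ (card_subsets_avoiding r.+1 mK)) => J /=; rewrite !inE /= EJ.
  by case: (m \in J); rewrite ?andbF ?andbT//= andbA.
case: ltnP => // Kr; have k0 : (#|K|.-1 < r)%N.
  by rewrite prednK ?(leq_trans _ Kr)//; apply/card_gt0P; exists m.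
by rewrite !bin_small// ltnW.
Qed.

Lemma sum_by_card (h : nat -> nat) :
  (\sum_(K : {set 'I_n}) h #|K| = \sum_(0 <= k < n.+1) 'C(n, k) * h k)%N.
Proof.
pose c (K : {set 'I_n}) : 'I_n.+1 := inord #|K|.
rewrite big_mkord (partition_big c predT) //=.
apply: eq_bigr => k _; rewrite -[n in 'C(n, _)]card_ord -card_draws.
have Kn (K : {set 'I_n}) : (#|K| < n.+1)%N.
  by rewrite ltnS -[n in (_ <= n)%N]card_ord max_card.
rewrite -sum_nat_const; apply: eq_big => K.
  by rewrite inE -val_eqE /= /c inordK.
by move=> /eqP <-; rewrite /c inordK.
Qed.

Lemma card_eigval r a :
  #|[pred F : {set 'I_n} * {set 'I_n} | faces r.+1 F & eigval R r F == a]| =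
  (\sum_(r.+1 <= k < n.+1) 'C(n, k) * mult r a k)%N.
Proof.
transitivity (\sum_(K : {set 'I_n})
    #|[pred J | faces r.+1 (K, J) & eigval R r (K, J) == a]|)%N.
  pose h K J :=
    if faces r.+1 (K, J) && (eigval R r (K, J) == a) then 1%N else 0%N.
  rewrite -sum1_card big_mkcond.
  transitivity (\sum_F h F.1 F.2)%N; first by apply: eq_bigr => -[].
  rewrite -(pair_bigA _ h); apply: eq_bigr => K _.
  by rewrite -sum1_card [RHS]big_mkcond.
rewrite (eq_bigr _ (fun K _ => card_faces_over r a K)).
rewrite (sum_by_card (fun k => if (r < k)%N then mult r a k else 0)%N).
rewrite [RHS](big_nat_widenl _ 0%N)// [RHS]big_mkcond.
by apply: eq_bigr => k _ /=; case: ltnP; rewrite ?muln0.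
Qed.

End Counting.

(** * The spectrum and the extreme eigenvalues *)

Section Multiplicities.
Variable R : realType.

Lemma big_msetE (I : Type) (s : seq I) (P : pred I) (F : I -> {mset R}) a :
  (\big[msetD/mset0]_(i <- s | P i) F i) a = (\sum_(i <- s | P i) F i a)%N.
Proof.
apply: (big_morph (fun A : {mset R} => A a)) => [A B|]; last exact: mset0E.
by rewrite msetE2.
Qed.

Lemma eq_ratio (j k q : nat) : (0 < q)%N ->
  ((2 * j)%:R / q%:R == (2 * k)%:R / q%:R :> R) = (j == k).
Proof.
move=> q0; have q0' : q%:R^-1 != 0 :> R by rewrite invr_eq0 pnatr_eq0 -lt0n.
by rewrite (inj_eq (mulIf q0')) eqr_nat eqn_pmul2l.
Qed.

Lemma eq2_ratio (k q : nat) : (0 < q)%N ->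
  (2%:R == (2 * k)%:R / q%:R :> R) = (q == k).
Proof.
move=> q0; rewrite -(eq_ratio q k q0) (natrM _ 2 q) mulfK//.
by rewrite pnatr_eq0 -lt0n.
Qed.

Lemma ratio_lt (j k p q : nat) : (0 < p)%N -> (k <= j)%N -> (0 < j)%N ->
  (p < q)%N -> (2 * k)%:R / q%:R < (2 * j)%:R / p%:R :> R.
Proof.
move=> p0 kj j0 pq; have q0 : (0 < q)%N by apply: leq_trans pq.
rewrite ltr_pdivrMr ?ltr0n// mulrAC ltr_pdivlMr ?ltr0n// -!natrM ltr_nat.
rewrite -!mulnA ltn_pmul2l//.
by rewrite (leq_ltn_trans (leq_mul kj (leqnn p)))// ltn_pmul2l.
Qed.

Variables (n r : nat).

Lemma mult_neq0 (a : R) k : (r < k <= n)%N -> mult r a k != 0%N ->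
  2%:R <= a <= (2 * n)%:R / r.+1%:R.
Proof.
move=> /andP[rk kn].
have le_ratio q : (r < q)%N -> (q <= k)%N ->
    2%:R <= ((2 * k)%:R / q%:R : R) <= (2 * n)%:R / r.+1%:R.
  move=> rq qk; have q0 : 0 < q%:R :> R by rewrite ltr0n (leq_trans _ rq).
  have r0 : 0 < r.+1%:R :> R by rewrite ltr0n.
  apply/andP; split; first by rewrite ler_pdivlMr// -natrM ler_nat leq_mul2l.
  rewrite ler_pdivrMr// mulrAC ler_pdivlMr// -!natrM ler_nat.
  by rewrite -!mulnA leq_mul2l leq_mul.
rewrite /mult addn_eq0 negb_and !muln_eq0 !eqb0 !negb_or !negbK.
case/orP => /andP[c0 /eqP ->]; first exact: le_ratio.
apply: le_ratio => //; move: c0; rewrite -lt0n bin_gt0.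
by case: (k) rk.
Qed.

Lemma sum_mult_max : (r < n)%N ->
  (\sum_(r.+1 <= k < n.+1) 'C(n, k) * mult r ((2 * n)%:R / r.+1%:R : R) k)%N
  = 'C(n.-1, r).
Proof.
move=> rn; have multE k : (k <= n)%N ->
    mult r ((2 * n)%:R / r.+1%:R : R) k = ('C(k.-1, r) * (n == k))%N.
  move=> kn; rewrite /mult eq_ratio// [in X in (_ + X)%N]gt_eqF ?muln0 ?addn0//.
  by apply: ratio_lt => //; apply: leq_trans rn.
rewrite big_nat_recr//= big_nat big1 => [|k /andP[_ kn]].
  by rewrite multE// eqxx muln1 binn mul1n.
by rewrite multE ?(ltnW kn)// gtn_eqF ?muln0.
Qed.

Lemma sum_mult_min : (r < n)%N ->
  (\sum_(r.+1 <= k < n.+1) 'C(n, k) * mult r (2%:R : R) k)%N = 'C(n.+1, r.+2).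
Proof.
move=> rn; have multE k : mult r (2%:R : R) k =
    ('C(k.-1, r) * (r.+1 == k) + 'C(k.-1, r.+1) * (r.+2 == k))%N.
  by rewrite /mult !eq2_ratio.
rewrite big_ltn// multE eqxx [r.+2 == r.+1]gtn_eqF// muln0 addn0.
rewrite binn !muln1 binS addnC; congr (_ + _)%N.
have [nr|nr] := leqP n r.+1; first by rewrite big_geq// bin_small.
rewrite big_ltn// multE eqxx [r.+1 == r.+2]ltn_eqF// muln0 add0n binn !muln1.
rewrite big_nat big1 ?addn0// => k /andP[rk _].
by rewrite multE !ltn_eqF ?muln0// ltnW.
Qed.

End Multiplicities.

Theorem theorem8p1 (R : realType) (n p : nat) (hp : (1 <= p)%N)
    (hpn : (p <= n)%N) :
  [/\ spec (Laplacian R (cube n) p) =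
        (\big[msetD/mset0]_(p <= k < n.+1)
            msetn ('C(n, k) * 'C(k.-1, p.-1))%N ((2 * k)%:R / p%:R : R))
        `+`
        (\big[msetD/mset0]_(p.+1 <= k < n.+1)
            msetn ('C(n, k) * 'C(k.-1, p))%N ((2 * k)%:R / p.+1%:R : R)),
      lambda_max (Laplacian R (cube n) p) ((2 * n)%:R / p%:R) 'C(n.-1, p.-1)
    & lambda_min (Laplacian R (cube n) p) 2%:R 'C(n.+1, p.+1)].
Proof.
case: p hp hpn => [//|r] _ rn.
have [phi [psi [phiK psiK arrowE]]] := cube_coordinates n.
have specE' a : spec (Laplacian R (cube n) r.+1) a =
    (\sum_(r.+1 <= k < n.+1) 'C(n, k) * mult r a k)%N.
  by rewrite (spec_faces phiK psiK arrowE) card_eigval.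
have bounds b : b \in spec (Laplacian R (cube n) r.+1) ->
    2%:R <= b <= (2 * n)%:R / r.+1%:R.
  rewrite -mset_neq0 specE' sum_nat_seq_neq0 => /hasP[k].
  rewrite mem_index_iota ltnS => rk /=; rewrite muln_eq0 negb_or => /andP[_].
  exact: (mult_neq0 rk).
split.
- apply/msetP => a; rewrite specE' msetE2 !big_msetE.
  have -> : (\sum_(r.+2 <= k < n.+1)
      msetn ('C(n, k) * 'C(k.-1, r.+1)) ((2 * k)%:R / r.+2%:R : R) a =
    \sum_(r.+1 <= k < n.+1)
      msetn ('C(n, k) * 'C(k.-1, r.+1)) ((2 * k)%:R / r.+2%:R : R) a)%N.
    by rewrite [RHS]big_ltn//= (@bin_small r r.+1)// muln0 msetn0 mset0E.
  rewrite -big_split /=; apply: eq_bigr => k _.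
  rewrite !msetnE mulnDr !mulnA.
  by case: eqP => _; case: eqP => _; rewrite ?muln1 ?muln0.
- split => [|b /bounds/andP[]//|]; last by rewrite specE' sum_mult_max.
  rewrite -mset_gt0 specE' sum_mult_max// bin_gt0 -ltnS prednK//.
  by rewrite (leq_trans _ rn).
- split => [|b /bounds/andP[]//|]; last by rewrite specE' sum_mult_min.
  by rewrite -mset_gt0 specE' sum_mult_min// bin_gt0 ltnS.
Qed.
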